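(* There is an absolute constant $C>0$ such that the following holds. Let $n\ge 1$ be an integer, let $u>0$ and $v>0$ be real, and put $w=u+v-n$, assuming $w>0$. Let $U_1,\ldots,U_n$ be independent random variables, each uniformly distributed on $[0,1]$, let $F_n(t)=\frac1n\#\{i: U_i\le t\}$ be their empirical distribution function, and let $$Q_n(u,v)=\mathbf{P}\Big(F_n(t)\le \frac{vt+u}{n}\ \text{ for all } 0\le t\le 1\Big).$$ Then $$\Big|\,Q_n(u,v)-\big(1-e^{-2uw/n}\big)\Big|\le C\,\frac{u+w}{n}.$$ *)

(* Defs.v *)
From HB Require Import structures.
From mathcomp Require Import all_boot all_order all_algebra.
From mathcomp Require Import all_classical all_reals all_analysis.
Set Implicit Arguments. Unset Strict Implicit. Unset Printing Implicit Defensive.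
Import Order.TTheory GRing.Theory Num.Theory.
Local Open Scope classical_set_scope.
Local Open Scope ring_scope.

(* Mutual independence of a finite family of real random variables
   U : 'I_n -> T -> R on a probability space P: for every family of
   measurable sets B_i, P(/\_i {U_i in B_i}) = prod_i P(U_i in B_i).
   (Taking B_j = setT for j outside a subfamily yields the product rule
   for every subfamily.) *)
Definition mutually_independent_RV {d : measure_display} {T : measurableType d}
  {R : realType} (P : probability T R) (n : nat) (U : 'I_n -> T -> R) : Prop :=
  forall B : 'I_n -> set R, (forall i, measurable (B i)) ->
    P (\bigcap_(i in [set: 'I_n]) (U i @^-1` B i)) =
    (\prod_(i < n) P (U i @^-1` B i))%E.

Definition uniform01_RV {d : measure_display} {T : measurableType d}
  {R : realType} (P : probability T R) (X : T -> R) : Prop :=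
  forall B : set R, measurable B ->
    P (X @^-1` B) = (@lebesgue_measure R) (B `&` `[0%R, 1%R]).

Definition empirical_df {T : Type} {R : realType} (n : nat)
  (U : 'I_n -> T -> R) (w : T) (t : R) : R :=
  (#|[set i : 'I_n | U i w <= t]|%:R / n%:R).

(* Main.v *)
(* Put Z_i = 1 - U_i and c(r) = (w + r)/v.  The bound on F_n fails iff #{i : Z_i <= c(r)} <= r
   for some integer 0 <= r < n - u.  Splitting according to the least such r, and the set S of the
   r indices counted there, the points of S form a parking configuration, independent of the
   remaining ones; Abel's identity gives it the probability w (w + r)^(r-1) / v^r, so that
     1 - Q_n = v^(-n) sum_{r < n - u} C(n, r) w (w + r)^(r-1) (n - r - u)^(n-r).
   Replacing -u by some s > 0 turns the terms into those of a probability law whose first two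
   moments are again given by Abel identities.  With j = n - r, the ratio of the terms is
   ((j - u)/(j + s))^j up to a constant; choose s so that it is stationary at j = n.  Then
   1 - Q_n is at most its value rho at j = n, and the loss is at most quadratic in
   1/(j + s) - 1/(n + s), whose variance is explicit and small enough.  Finally rho is
   ((n - u)(n + s + w)/((n + s)(n - u + w)))^n, which is close to exp(-2uw/n). *)
Require Import Defs.
From HB Require Import structures.
From mathcomp Require Import all_boot all_order all_algebra.
From mathcomp Require Import all_classical all_reals all_analysis.
From mathcomp Require Import ring lra zify.
Set Implicit Arguments. Unset Strict Implicit. Unset Printing Implicit Defensive.
Import Order.TTheory GRing.Theory Num.Theory.
Import numFieldNormedType.Exports.
Local Open Scope ring_scope.

(** * Abel identities *)

Lemma sum_binS (R : comNzRingType) (n : nat) (F : nat -> R) :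
  \sum_(r < n.+2) 'C(n.+1, r)%:R * F r =
  \sum_(r < n.+1) 'C(n, r)%:R * F r + \sum_(r < n.+1) 'C(n, r)%:R * F r.+1.
Proof.
rewrite big_ord_recl /= bin0 [X in _ = X + _]big_ord_recl /= bin0 -addrA.
congr (_ + _).
under eq_bigr => i _ do rewrite /bump /= add1n binS natrD mulrDl.
rewrite big_split /=; congr (_ + _).
by rewrite big_ord_recr /= bin_small // mul0r addr0.
Qed.

(** The [N]-th finite difference kills polynomials of degree below [N], since each difference lowers
    the degree by one. *)
Lemma finite_difference0 (R : comNzRingType) (N e : nat) (x : R) : (e < N)%N ->
  \sum_(r < N.+1) 'C(N, r)%:R * ((-1) ^+ (N - r) * (x + r%:R) ^+ e) = 0.
Proof.
elim: N e x => // N IHN e x; rewrite ltnS => leN.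
rewrite (sum_binS N (fun r => (-1) ^+ (N.+1 - r) * (x + r%:R) ^+ e)).
rewrite -big_split /=.
(* One difference [(x + r + 1)^e - (x + r)^e] expands into powers [i < e], to which the induction
   hypothesis applies. *)
transitivity (\sum_(r < N.+1) \sum_(i < e) 'C(e, i)%:R *
    ('C(N, r)%:R * ((-1) ^+ (N - r) * (x + r%:R) ^+ i))).
  apply: eq_bigr => r _.
  rewrite subSS subSn; last by rewrite -ltnS.
  rewrite exprS -[r.+1%:R]natr1 addrA.
  rewrite [(_ + 1) ^+ e]exprD1n big_ord_recr /= binn mulr1n.
  transitivity ('C(N, r)%:R * ((-1) ^+ (N - r) *
     (\sum_(i < e) (x + r%:R) ^+ i *+ 'C(e, i)))); first by ring.
  rewrite !mulr_sumr; apply: eq_bigr => i _.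
  by rewrite -mulr_natl; ring.
rewrite exchange_big big1 //= => i _.
rewrite -mulr_sumr IHN ?mulr0 //.
exact: leq_trans (ltn_ord i) leN.
Qed.

(* [x (x + r)^(r-1)] *)
Definition abel (R : fieldType) (x : R) (r : nat) : R := x * (x + r%:R) ^+ r / (x + r%:R).

Lemma abelS (R : fieldType) (x : R) (r : nat) : x + r.+1%:R != 0 ->
  abel x r.+1 = x * (x + r.+1%:R) ^+ r.
Proof. by move=> h; rewrite /abel exprSr mulrA mulfK. Qed.

Lemma abel0 (R : fieldType) (x : R) : x != 0 -> abel x 0 = 1.
Proof. by move=> h; rewrite /abel addr0 expr0 mulr1 divff. Qed.

(** With [z = x + y + n], expand [y + n - r = z - (x + r)] in powers of [z]. For [k < n] the
    coefficient of [z^k] is a finite difference of order [n - k] of a polynomial of degree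
    [n - k - 1], hence zero; only [z^n], coming from [r = 0], survives. *)
Lemma abel_identity (R : fieldType) (n : nat) (x y : R) :
  (forall r : nat, x + r%:R != 0) ->
  \sum_(r < n.+1) 'C(n, r)%:R * (abel x r * (y + n%:R - r%:R) ^+ (n - r)) =
  (x + y + n%:R) ^+ n.
Proof.
(* The indicator term is the contribution of [k = n], kept apart because the exponent [(n - k).-1]
   is truncated there. *)
move=> x0; set z := x + y + n%:R.
transitivity (\sum_(r < n.+1) \sum_(k < n.+1)
   'C(n, k)%:R * z ^+ k * (x * ('C(n - k, r)%:R *
     ((-1) ^+ (n - k - r) * (x + r%:R) ^+ (n - k).-1 )) *+ (k < n)%N
    + (k == n :> nat)%:R * (r == 0%N :> nat)%:R)).
  apply: eq_bigr => r _.
  have rn : (r <= n)%N by rewrite -ltnS.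
  have -> : y + n%:R - r%:R = - (x + r%:R) + z by rewrite /z; ring.
  rewrite exprDn.
  rewrite (big_ord_widen n.+1 (fun i => (- (x + r%:R)) ^+ (n - r - i) * z ^+ i *+ 'C(n - r, i))); last by lia.
  rewrite big_mkcond /= !mulr_sumr; apply: eq_bigr => k _.
  have kn : (k <= n)%N by rewrite -ltnS.
  case: ifPn => hk; last first.
    have -> : (k == n :> nat)%:R * (r == 0%N :> nat)%:R = 0 :> R.
      case: eqP => [|_]; rewrite ?mul0r //; case: eqP; rewrite ?mulr0 //.
      lia.
    by rewrite [in 'C(n - k, r)]bin_small ?mul0r ?mulr0 ?mul0rn ?addr0 ?mulr0 //; lia.
  have binE : 'C(n, r)%:R * 'C(n - r, k)%:R = 'C(n, k)%:R * 'C(n - k, r)%:R :> R.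
    rewrite -!natrM; congr (_%:R).
    have f0 : (0 < k`! * r`! * (n - r - k)`!)%N by rewrite !muln_gt0 !fact_gt0.
    apply/eqP; rewrite -(eqn_pmul2r f0); apply/eqP.
    have e1 := bin_fact rn.
    have e2 : ('C(n - r, k) * (k`! * (n - r - k)`!))%N = (n - r)`! by apply: bin_fact; lia.
    have e3 := bin_fact kn.
    have e4 : ('C(n - k, r) * (r`! * (n - k - r)`!))%N = (n - k)`! by apply: bin_fact; lia.
    have e5 : (n - k - r = n - r - k)%N by lia.
    rewrite e5 in e4; rewrite -e2 in e1; rewrite -e4 in e3.
    nia.
  case: (ltnP k n) => hkn.
    have -> : (k == n :> nat) = false by lia.
    rewrite mul0r addr0 mulr1n [(- (x + _)) ^+ _]exprNn.
    rewrite -[_ *+ 'C(n - r, k)]mulr_natr.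
    have -> : (n - k - r = n - r - k)%N by lia.
    transitivity ('C(n, r)%:R * 'C(n - r, k)%:R * z ^+ k * (-1) ^+ (n - r - k) *
      (abel x r * (x + r%:R) ^+ (n - r - k))); first by ring.
    rewrite binE.
    have -> : abel x r * (x + r%:R) ^+ (n - r - k) = x * (x + r%:R) ^+ (n - k).-1.
      rewrite /abel.
      have e : (n - k = r + (n - r - k))%N by lia.
      have e' : (n - k = (n - k).-1.+1)%N by lia.
      rewrite mulrAC -[_ * _ * (x + r%:R) ^+ (n - r - k)]mulrA -exprD -e e' exprSr mulrA mulfK //.
    ring.
  have kE : k = n :> nat by lia.
  have r0 : r = 0%N :> nat by lia.
  rewrite r0 kE eqxx mulr0n add0r subn0 subnn bin0 expr0 abel0; last by have := x0 0%N; rewrite addr0.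
  by rewrite binn mulr1n /= !mul1r !mulr1.
rewrite exchange_big big_ord_recr /= big1 ?add0r.
  under eq_bigr => r _ do rewrite ltnn mulr0n add0r eqxx mul1r.
  rewrite -mulr_sumr binn mul1r big_ord_recl /= big1 ?addr0 ?mulr1 //.
move=> k _; rewrite -mulr_sumr big_split /= [X in _ + X]big1; last first.
  by move=> r _; rewrite (_ : (k == n :> nat) = false) ?mul0r //; have := ltn_ord k; lia.
rewrite addr0.
have kn : (k < n)%N by [].
under eq_bigr => r _ do rewrite kn mulr1n.
rewrite -mulr_sumr.
rewrite [X in x * X](_ : _ = 0) ?mulr0 //.
rewrite -(big_mkord xpredT (fun r => 'C(n - k, r)%:R * ((-1) ^+ (n - k - r) * (x + r%:R) ^+ (n - k).-1))).
rewrite (@big_cat_nat _ _ _ (n - k).+1) //=; last by lia.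
rewrite [X in _ + X]big_nat_cond [X in _ + X]big1 ?addr0; last first.
  by move=> r /andP[/andP[h _] _]; rewrite bin_small // mul0r.
by rewrite big_mkord; apply: finite_difference0; lia.
Qed.

(** Write [y = (y + j) - j] in [y (y + j)^(j-1)]. The factor [j] makes the truncated exponent
    harmless at [j = 0]. *)
Lemma abel_shift (R : fieldType) (y : R) (j : nat) : y + j%:R != 0 ->
  abel y j = (y + j%:R) ^+ j - j%:R * (y + j%:R) ^+ j.-1.
Proof.
case: j => [|j] h; first by rewrite addr0 in h; rewrite abel0 // expr0 mul0r subr0.
by rewrite abelS //= exprS; ring.
Qed.

(* The sum over [r] below is reindexed by [j = n - r]; peeling a factor [j] off
   [C(n, j)] lowers [n] and raises [y] by one, keeping [y + n]. *)
Lemma abel_peel (R : comNzRingType) (n : nat) (x : nat -> R) (F : nat -> R) :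
  \sum_(r < n.+2) 'C(n.+1, r)%:R * (x r * ((n.+1 - r)%:R * F (n - r)%N)) =
  n.+1%:R * \sum_(r < n.+1) 'C(n, r)%:R * (x r * F (n - r)%N).
Proof.
rewrite big_ord_recr /= subnn mul0r !mulr0 addr0 mulr_sumr.
apply: eq_bigr => r _.
have rn : (r <= n)%N by rewrite -ltnS.
have E : ('C(n.+1, r) * (n.+1 - r) = n.+1 * 'C(n, r))%N.
  by rewrite mulnC mul_bin_down.
transitivity (('C(n.+1, r) * (n.+1 - r))%:R * (x r * F (n - r)%N)).
  by rewrite natrM; ring.
by rewrite E natrM; ring.
Qed.

(** Apply [abel_shift] to the factor in [y] and to the right-hand side. The leading pieces match by
    [abel_identity] in degree [n]; the subtracted ones match, after [abel_peel], by [abel_identity]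
    in degree [n - 1] with [y + 1] for [y]. *)
Lemma abel_convolution (R : fieldType) (n : nat) (x y : R) :
  (forall r : nat, x + r%:R != 0) -> (forall r : nat, y + r%:R != 0) ->
  x + y + n%:R != 0 ->
  \sum_(r < n.+1) 'C(n, r)%:R * (abel x r * abel y (n - r)) = abel (x + y) n.
Proof.
move=> x0 y0 xy0; rewrite abel_shift //.
under eq_bigr => r _ do rewrite [abel y _]abel_shift // mulrBr mulrBr.
rewrite sumrB; congr (_ - _).
  rewrite -abel_identity //; apply: eq_bigr => r _; congr (_ * (_ * _ ^+ _)).
  by rewrite natrB ?addrA // -ltnS.
case: n xy0 => [|n] xy0.
  by rewrite big_ord1 subnn !mul0r !mulr0.
transitivity (\sum_(r < n.+2) 'C(n.+1, r)%:R *
    (abel x r * ((n.+1 - r)%:R * (y + 1 + (n - r)%:R) ^+ (n - r)))).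
  apply: eq_bigr => r _; congr (_ * (_ * _)).
  rewrite (_ : (n - r = (n.+1 - r).-1)%N); last by lia.
  case: (n.+1 - r)%N => [|j] /=; first by rewrite !mul0r.
  by congr (_ * _ ^+ _); rewrite -[j.+1%:R]natr1; ring.
rewrite (abel_peel _ _ (fun j => (y + 1 + j%:R) ^+ j)) /=; congr (_ * _).
rewrite (_ : x + y + n.+1%:R = x + (y + 1) + n%:R); last by rewrite -natr1; ring.
rewrite -abel_identity //; apply: eq_bigr => r _; congr (_ * (_ * _ ^+ _)).
by rewrite natrB ?addrA // -ltnS.
Qed.

(** Rests on [(y + 1) y^2 (y + j)^(j-2) = (y + 1) abel y j - y j abel (y + 1) (j - 1)], which
    reduces the sum to two instances of [abel_convolution]. It will provide a second moment. *)
Lemma abel_convolution2 (R : fieldType) (n : nat) (x y : R) :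
  (forall r : nat, x + r%:R != 0) -> (forall r : nat, y + r%:R != 0) ->
  (forall r : nat, x + y + r%:R != 0) ->
  (y + 1) * \sum_(r < n.+1) 'C(n, r)%:R *
     (abel x r * (y ^+ 2 * (y + (n - r)%:R) ^+ (n - r) / (y + (n - r)%:R) ^+ 2)) =
  (y + 1) * abel (x + y) n - y * (n%:R * abel (x + y + 1) n.-1).
Proof.
move=> x0 y0 xy0.
have y00 : y != 0 by have := y0 0%N; rewrite addr0.
pose F j := abel (y + 1) j.
transitivity (\sum_(r < n.+1) ((y + 1) * ('C(n, r)%:R * (abel x r * abel y (n - r))) -
    y * ('C(n, r)%:R * (abel x r * ((n - r)%:R * F (n - r).-1))))).
  rewrite mulr_sumr; apply: eq_bigr => r _.
  suff h : y ^+ 2 * (y + (n - r)%:R) ^+ (n - r) / (y + (n - r)%:R) ^+ 2 * (y + 1) =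
     (y + 1) * abel y (n - r) - y * ((n - r)%:R * F (n - r).-1) :> R.
    transitivity ('C(n, r)%:R * (abel x r * (y ^+ 2 * (y + (n - r)%:R) ^+ (n - r) /
      (y + (n - r)%:R) ^+ 2 * (y + 1)))); first by ring.
    by rewrite h; ring.
  case: (n - r)%N => [|j].
    by rewrite addr0 mul0r mulr0 subr0 abel0 // expr0 mulr1 divff ?mul1r ?mulr1 // expf_neq0.
  rewrite /= /F abelS // /abel.
  have h : y + 1 + j%:R = y + j.+1%:R by rewrite -natr1; ring.
  have t0 := y0 j.+1.
  rewrite h; set t := y + j.+1%:R in t0 *.
  rewrite (_ : j.+1%:R = t - y) /t; last by rewrite addrAC subrr add0r.
  rewrite -/t [t ^+ j.+1]exprS; move: t t0 => t t0.
  by field.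
rewrite sumrB -!mulr_sumr abel_convolution //; congr (_ - _ * _).
case: n => [|n]; first by rewrite big_ord1 subnn !mul0r !mulr0.
transitivity (\sum_(r < n.+2) 'C(n.+1, r)%:R *
    (abel x r * ((n.+1 - r)%:R * F (n - r)%N))).
  by apply: eq_bigr => r _; rewrite (_ : (n - r = (n.+1 - r).-1)%N) //; lia.
rewrite abel_peel /= /F abel_convolution ?addrA // => [r|].
  by have := y0 r.+1; rewrite -natr1 addrAC addrA.
by have := xy0 n.+1; rewrite -natr1 addrA addrAC.
Qed.

(** * Finite product laws and parking configurations *)

Section Product.
Variables (R : comNzRingType) (I J : finType) (lam : J -> R).
Hypothesis lam1 : \sum_k lam k = 1.
Implicit Types (a : {ffun I -> J}) (F : {ffun I -> J} -> R) (S : {set I}).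

Definition expect F : R := \sum_a F a * \prod_i lam (a i).

Lemma expect1 : expect (fun=> 1) = 1.
Proof.
rewrite /expect; under eq_bigr do rewrite mul1r.
rewrite -(bigA_distr_bigA (fun (i : I) j => lam j)).
by rewrite big1.
Qed.

Lemma eq_expect F G : F =1 G -> expect F = expect G.
Proof. by move=> FG; apply: eq_bigr => a _; rewrite FG. Qed.

Lemma expect_sum (T : Type) (r : seq T) (P : pred T) (F : T -> {ffun I -> J} -> R) :
  expect (fun a => \sum_(t <- r | P t) F t a) = \sum_(t <- r | P t) expect (F t).
Proof.
rewrite /expect exchange_big; apply: eq_bigr => a _.
by rewrite mulr_suml.
Qed.

Lemma expectB F G : expect (fun a => F a - G a) = expect F - expect G.
Proof. by rewrite /expect -sumrB; apply: eq_bigr => a _; rewrite mulrBl. Qed.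

Definition upd a (i : I) (k : J) : {ffun I -> J} :=
  [ffun i' => if i' == i then k else a i'].

(* Swapping the [i]-th coordinate with a fresh independent copy preserves the law. *)
Lemma expect_indep1 (i : I) (h : J -> R) F :
  (forall a k, F (upd a i k) = F a) ->
  expect (fun a => F a * h (a i)) = expect F * \sum_k lam k * h k.
Proof.
move=> Fi.
pose w a := \prod_i lam (a i).
have wE a k : w (upd a i k) * lam (a i) = w a * lam k.
  rewrite /w (bigD1 i) //= [in RHS](bigD1 i) //= ffunE eqxx.
  rewrite (eq_bigr (fun i' => lam (a i'))); first by ring.
  by move=> i' /negbTE ii'; rewrite ffunE ii'.
pose sw (p : {ffun I -> J} * J) := (upd p.1 i p.2, p.1 i).
have swK : involutive sw.
  move=> [a k]; rewrite /sw /= ffunE eqxx; congr pair.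
  by apply/ffunP => i'; rewrite !ffunE; case: eqP => // ->.
transitivity (\sum_(p : {ffun I -> J} * J) F p.1 * h (p.1 i) * w p.1 * lam p.2).
  rewrite -(pair_bigA _ (fun a k => F a * h (a i) * w a * lam k)) /=.
  by apply: eq_bigr => a _; rewrite -mulr_sumr lam1 mulr1.
transitivity (\sum_(p : {ffun I -> J} * J) F p.1 * w p.1 * (lam p.2 * h p.2)).
  rewrite (reindex_inj (inv_inj swK)) /=; apply: eq_bigr => -[a k] _ /=.
  rewrite Fi ffunE eqxx.
  transitivity (F a * h k * (w (upd a i k) * lam (a i))); first by ring.
  by rewrite wE; ring.
rewrite -(pair_bigA _ (fun a k => F a * w a * (lam k * h k))) /=.
rewrite /expect mulr_suml; apply: eq_bigr => a _.
by rewrite mulr_sumr.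
Qed.

Lemma expect_indep (s : seq I) (h : J -> R) F : uniq s ->
  (forall i a k, i \in s -> F (upd a i k) = F a) ->
  expect (fun a => F a * \prod_(i <- s) h (a i)) =
  expect F * (\sum_k lam k * h k) ^+ size s.
Proof.
elim: s => [|i s IHs] /=; first by move=> _ _; under eq_expect do rewrite big_nil mulr1; rewrite mulr1.
move=> /andP[is_ us] Fs.
transitivity (expect (fun a => F a * (\prod_(j <- s) h (a j)) * h (a i))).
  by apply: eq_expect => a; rewrite big_cons; ring.
rewrite (@expect_indep1 i h (fun a => F a * (\prod_(j <- s) h (a j)))).
  rewrite IHs ?exprSr ?mulrA // => j a k js.
  by apply: Fs; rewrite inE js orbT.
move=> a k; rewrite Fs ?mem_head //; congr (_ * _).
apply: eq_big_seq => j js; rewrite ffunE; case: eqP => // ji.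
by rewrite -ji js in is_.
Qed.

Lemma expect_indep_set S (h : J -> R) F :
  (forall i a k, i \in S -> F (upd a i k) = F a) ->
  expect (fun a => F a * \prod_(i in S) h (a i)) =
  expect F * (\sum_k lam k * h k) ^+ #|S|.
Proof.
move=> FS; under eq_expect do rewrite -big_enum.
rewrite expect_indep ?enum_uniq // -?cardE // => i a k.
by rewrite mem_enum; apply: FS.
Qed.
End Product.

Lemma sum_subsets (R : comNzRingType) (I : finType) (S : {set I}) (K : nat) (f : nat -> R) :
  (K <= #|S|.+1)%N ->
  \sum_(S' : {set I} | (S' \subset S) && (#|S'| < K)%N) f #|S'| =
  \sum_(r < K) 'C(#|S|, r)%:R * f r.
Proof.
case: K => [|K] hK.
  by rewrite big_ord0 big_pred0 // => S'; rewrite ltn0 andbF.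
rewrite (partition_big (fun S' : {set I} => inord #|S'| : 'I_K.+1) xpredT) //=.
apply: eq_bigr => r _.
transitivity (\sum_(S' in [set S' : {set I} | (S' \subset S) & (#|S'| == r)]) f r).
  apply: eq_big => [S'|S' /andP[/andP[_ h] /eqP <-]]; last by rewrite inordK.
  rewrite inE -andbA; congr andb; apply/andP/eqP => [[h /eqP <-]|h].
    by rewrite inordK.
  by rewrite h; split=> //; apply/eqP/val_inj; rewrite /= inordK.
by rewrite sumr_const cards_draws mulr_natl.
Qed.

Lemma prod_indicator (R : comNzRingType) (I : finType) (A p : pred I) :
  \prod_(i | A i) (p i)%:R = [forall (i | A i), p i]%:R :> R.
Proof.
have [/forall_inP h|] := boolP [forall (i | A i), p i].
  by rewrite big1 // => i /h ->.
rewrite negb_forall => /existsP[i]; rewrite negb_imply => /andP[Ai /negbTE pi].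
by rewrite (bigD1 i) //= pi mul0r.
Qed.

(** * Parking configurations and the first crossing index *)

Section Parking.
Variables (R : fieldType) (I : finType) (N : nat) (lam : 'I_N.+1 -> R).
Hypothesis lam1 : \sum_k lam k = 1.
Implicit Types (a : {ffun I -> 'I_N.+1}) (S : {set I}).

Definition level S a (r : nat) : {set I} := [set i in S | (a i <= r)%N].

(** The classical parking functions: cars in [S] prefer the spots [a i], numbered from [0], and all
    of them can park within the first [#|S|] spots. *)
Definition parking S a : bool := [forall r : 'I_#|S|, (r < #|level S a r|)%N].

Lemma parkingP S a : reflect (forall r, (r < #|S|)%N -> (r < #|level S a r|)%N) (parking S a).
Proof.
apply: (iffP forallP) => [h r rS|h r]; last exact: h.
exact: (h (Ordinal rS)).
Qed.

Lemma parking_lt S a i : parking S a -> i \in S -> (a i < #|S|)%N.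
Proof.
move=> /parkingP h iS.
have S0 : (0 < #|S|)%N by apply/card_gt0P; exists i.
have := h #|S|.-1; rewrite prednK // leqnn => /(_ isT) hS.
have lS : level S a #|S|.-1 \subset S by apply/fintype.subsetP => j; rewrite inE => /andP[].
have /eqP E : level S a #|S|.-1 == S by rewrite eqEcard lS.
by move: iS; rewrite -{1}E inE => /andP[_]; rewrite -ltnS prednK.
Qed.

Lemma level_parking S S' a : S' \subset S -> parking S' a ->
  (forall i, i \in S :\: S' -> (#|S'| < a i)%N) -> level S a #|S'| = S'.
Proof.
move=> /fintype.subsetP sS pS' h; apply/setP => i; rewrite inE.
have [iS'|iS'] := boolP (i \in S').
  by rewrite sS // ltnW // parking_lt.
have [iS|//] := boolP (i \in S).
by apply/negbTE; rewrite -ltnNge h // inE iS' iS.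
Qed.

(* The terms on the right are disjoint: the nonzero one is [S' = level S a r] for the least
   [r] with [#|level S a r| <= r]. *)
Lemma parking_decomposition S a (K b : nat) : (K <= b.+1)%N ->
  (\prod_(i in S) (a i <= b)%N%:R) * [exists r : 'I_K, (#|level S a r| <= r)%N]%:R =
  \sum_(S' : {set I} | (S' \subset S) && (#|S'| < K)%N)
    (parking S' a)%:R * \prod_(i in S :\: S') (#|S'| < a i <= b)%N%:R :> R.
Proof.
move=> Kb.
have key S' : S' \subset S -> (#|S'| < K)%N ->
    (parking S' a)%:R * \prod_(i in S :\: S') (#|S'| < a i <= b)%N%:R != 0 :> R ->
    level S a #|S'| = S' /\ parking S' a.
  move=> sS _; rewrite prod_indicator -natrM mulnb.
  case: andP => [[pS' /forall_inP h] _|_]; last by rewrite eqxx.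
  split=> //; apply: level_parking => // i /h /andP[]//.
have [/existsP[r0 hr0]|hex] := boolP [exists r : 'I_K, (#|level S a r| <= r)%N]; last first.
  rewrite mulr0 big1 // => S' /andP[sS S'K]; apply/eqP/negP => /negP/key -/(_ sS S'K)[E _].
  by case/existsP: hex; exists (Ordinal S'K); rewrite /= E.
rewrite mulr1.
have ex : exists r, (#|level S a r| <= r)%N by exists r0.
case: (ex_minnP ex) => r hr rmin.
have rK : (r < K)%N by apply: leq_ltn_trans (rmin _ hr0) (ltn_ord r0).
have cr : #|level S a r| = r.
  apply/eqP; rewrite eqn_leq hr /=.
  case: r {hr rK} rmin => // r rmin.
  rewrite ltnNge; apply/negP => h.
  suff /rmin : (#|level S a r| <= r)%N by rewrite ltnn.
  apply: leq_trans h; apply/subset_leq_card/fintype.subsetP => i.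
  by rewrite !inE => /andP[-> /leqW].
have lS : level S a r \subset S by apply/fintype.subsetP => j; rewrite inE => /andP[].
have pl : parking (level S a r) a.
  apply/parkingP => r'; rewrite cr => r'r.
  have -> : level (level S a r) a r' = level S a r'.
    apply/setP => i; rewrite !inE; case: (i \in S) => //=.
    by apply/andP/idP => [[]//|h]; split=> //; apply: leq_trans h (ltnW r'r).
  by rewrite ltnNge; apply/negP => /rmin; rewrite leqNgt r'r.
rewrite (bigD1 (level S a r)) /=; last by rewrite lS cr.
rewrite [X in _ + X]big1 ?addr0; last first.
  (* Any other set with a nonzero term is the level of its own size; being parking, it admits no
     crossing index below that size, which is therefore the minimal [r]. *)
  move=> S' /andP[/andP[sS S'K] S'l]; apply/eqP/negP => /negP/key -/(_ sS S'K)[E pS'].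
  case/eqP: S'l; rewrite -E; congr (level S a _).
  apply/eqP; rewrite eqn_leq rmin ?E // andbT leqNgt; apply/negP => rS'.
  move/parkingP: pS' => /(_ r rS'); rewrite ltnNge; apply/negP/negPn.
  rewrite -[X in (_ <= X)%N]cr.
  apply/subset_leq_card/fintype.subsetP => i.
  by rewrite !inE => /andP[/(fintype.subsetP sS) -> ->].
rewrite pl mul1r cr (big_setID (level S a r)) /= big1 ?mul1r.
  apply: eq_bigr => i; rewrite !inE negb_and => /andP[/orP[/negbTE->//|]].
  by rewrite -ltnNge => ->.
move=> i; rewrite !inE => /and3P[_ _ h].
by rewrite (leq_trans h) //; rewrite -ltnS (leq_trans rK).
Qed.

Lemma parking_upd S a i k : i \notin S -> parking S (upd a i k) = parking S a.
Proof.
move=> iS; apply: eq_forallb => r; congr (_ < #|pred_of_set _|)%N; apply/setP => j.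
rewrite !inE ffunE; case: eqP => // ->.
by rewrite (negbTE iS).
Qed.

(** Whether [S'] is parking depends on the coordinates in [S'] alone, so each term of
    [parking_decomposition] factors by independence. *)
Lemma expect_parking_decomposition S (K b : nat) : (K <= b.+1)%N ->
  expect lam (fun a => (\prod_(i in S) (a i <= b)%N%:R) *
     [exists r : 'I_K, (#|level S a r| <= r)%N]%:R) =
  \sum_(S' : {set I} | (S' \subset S) && (#|S'| < K)%N)
    expect lam (fun a => (parking S' a)%:R) *
    (\sum_k lam k * (#|S'| < k <= b)%N%:R) ^+ (#|S| - #|S'|).
Proof.
move=> Kb.
under eq_expect => a do rewrite parking_decomposition //.
rewrite expect_sum; apply: eq_bigr => S' /andP[sS _].
rewrite (@expect_indep_set _ _ _ lam lam1 (S :\: S') (fun k => (#|S'| < k <= b)%N%:R)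
  (fun a => (parking S' a)%:R)).
  by rewrite cardsD (finset.setIidPr sS).
by move=> i a k; rewrite inE => /andP[iS' _]; rewrite parking_upd.
Qed.

Variables (w v : R) (K : nat).
Hypothesis w0 : forall r : nat, w + r%:R != 0.
Hypothesis v0 : v != 0.
Hypothesis lamK : forall r, (r < K)%N -> \sum_k lam k * (k <= r)%N%:R = (w + r%:R) / v.

Lemma sum_lam_between r m : (r <= m)%N -> 
  \sum_k lam k * (r < k <= m)%N%:R =
  \sum_k lam k * (k <= m)%N%:R - \sum_k lam k * (k <= r)%N%:R.
Proof.
move=> rm; rewrite -sumrB; apply: eq_bigr => k _; rewrite -mulrBr; congr (_ * _).
case: (leqP k r) => kr /=; last by rewrite subr0.
by rewrite (leq_trans kr rm) subrr.
Qed.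

(** Strong induction on [n = #|S|]. In the decomposition with [K = n + 1] and [b = n] the index
    [r = n] always qualifies, so the left side is [((w + n)/v)^n]. The Abel identity at [y = 0]
    expands this same power; the terms of proper subsets agree by induction, hence so do the terms
    of [S]. *)
Lemma expect_parking S : (#|S| < K)%N ->
  expect lam (fun a => (parking S a)%:R) = abel w #|S| / v ^+ #|S|.
Proof.
have [m] := ubnP #|S|; elim: m S => // m IHm S; rewrite ltnS => Sm SK.
set n := #|S|.
pose f r := abel w r / v ^+ r * ((n%:R - r%:R) / v) ^+ (n - r).
have Hd := @expect_parking_decomposition S n.+1 n (leqnn _).
move: Hd.
have -> : expect lam (fun a => (\prod_(i in S) (a i <= n)%N%:R) *
     [exists r : 'I_n.+1, (#|level S a r| <= r)%N]%:R) = ((w + n%:R) / v) ^+ n.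
  transitivity (expect lam (fun a => 1 * \prod_(i in S) (a i <= n)%N%:R)).
    apply: eq_expect => a; rewrite mulrC; congr (_ * _).
    rewrite (_ : [exists r, _] = true) //; apply/existsP; exists ord_max => /=.
    by apply/subset_leq_card/fintype.subsetP => i; rewrite inE => /andP[].
  rewrite (@expect_indep_set _ _ _ lam lam1 S (fun k => (k <= n)%N%:R) (fun=> 1)) //.
  by rewrite expect1 // mul1r lamK.
have E S' : (S' \subset S) && (#|S'| < n.+1)%N ->
    (\sum_k lam k * (#|S'| < k <= n)%N%:R) ^+ (n - #|S'|) = ((n%:R - #|S'|%:R) / v) ^+ (n - #|S'|).
  move=> /andP[_ S'n]; rewrite sum_lam_between // !lamK ?(leq_trans S'n SK) //.
  by congr (_ ^+ _); ring.
rewrite [X in _ = X -> _](eq_bigr (fun S' : {set I} => expect lam (fun a => (parking S' a)%:R) *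
  ((n%:R - #|S'|%:R) / v) ^+ (n - #|S'|))); last by move=> S' hS'; rewrite E.
have -> : ((w + n%:R) / v) ^+ n =
    \sum_(S' : {set I} | (S' \subset S) && (#|S'| < n.+1)%N) f #|S'|.
  rewrite sum_subsets // expr_div_n -[w]addr0 -abel_identity ?addr0 // mulr_suml.
  apply: eq_bigr => r _; rewrite /f add0r expr_div_n.
  have -> : v ^+ n = v ^+ r * v ^+ (n - r) by rewrite -exprD subnKC // -ltnS.
  by rewrite invfM; ring.
have SS : (S \subset S) && (#|S| < n.+1)%N by rewrite subxx ltnSn.
rewrite (bigD1 S SS) /= [X in _ = X -> _](bigD1 S SS) /=.
rewrite -/n subnn !expr0 mulr1 {1}/f subnn expr0 mulr1.
rewrite [X in _ + X = _ -> _](eq_bigr (fun S' : {set I} =>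
    expect lam (fun a => (parking S' a)%:R) * ((n%:R - #|S'|%:R) / v) ^+ (n - #|S'|))).
  by move/addIr => ->.
move=> S' /andP[/andP[sS S'n] S'S]; rewrite IHm //.
  by apply: leq_trans Sm; apply: proper_card; rewrite finset.properEneq S'S.
exact: leq_ltn_trans SK.
Qed.

(** Decompose over the whole of [I] with [b = N], where [a i <= N] is vacuous, and pass to the
    complement. *)
Lemma expect_stay_above : (K <= #|I|.+1)%N -> (K <= N.+1)%N ->
  expect lam (fun a => [forall r : 'I_K, (r < #|[set i | (a i <= r)%N]|)%N]%:R) =
  1 - \sum_(r < K) 'C(#|I|, r)%:R * (abel w r / v ^+ r * ((v - w - r%:R) / v) ^+ (#|I| - r)).
Proof.
move=> KI KN.
have levT a r : level [set: I]%SET a r = [set i | (a i <= r)%N] by apply/setP => i; rewrite !inE.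
transitivity (expect lam (fun a => 1 - (\prod_(i in [set: I]%SET) (a i <= N)%N%:R) *
     [exists r : 'I_K, (#|level [set: I]%SET a r| <= r)%N]%:R)).
  apply: eq_expect => a; rewrite big1 ?mul1r; last by move=> i _; rewrite -ltnS ltn_ord.
  have -> : [forall r : 'I_K, (r < #|[set i | (a i <= r)%N]|)%N] =
     ~~ [exists r : 'I_K, (#|level [set: I]%SET a r| <= r)%N].
    by rewrite negb_exists; apply: eq_forallb => r; rewrite levT -ltnNge.
  by case: [exists _, _]; rewrite ?subrr ?subr0.
rewrite expectB expect1 // expect_parking_decomposition //; congr (_ - _).
rewrite -cardsT -(@sum_subsets _ _ [set: I]%SET K (fun r => abel w r / v ^+ r *
  ((v - w - r%:R) / v) ^+ (#|[set: I]%SET| - r))) ?cardsT //.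
apply: eq_bigr => S' /andP[_ S'K].
rewrite expect_parking // sum_lam_between; last by rewrite -ltnS (leq_trans S'K).
rewrite (lamK S'K) (_ : \sum_k lam k * (k <= N)%N%:R = 1).
  by congr (_ * _ ^+ _); rewrite -{1}(divff v0); ring.
by rewrite -[RHS]lam1; apply: eq_bigr => k _; rewrite -ltnS ltn_ord mulr1.
Qed.
End Parking.

(** * Exact formula for the crossing probability *)

Local Open Scope classical_set_scope.
Local Open Scope ring_scope.

Lemma measure_finite_fibers (d : measure_display) (T : measurableType d) (R : realType)
  (mu : {measure set T -> \bar R}) (F : finType) (X : T -> F) (A : pred F) :
  (forall a, measurable (X @^-1` [set a])) ->
  mu [set x | A (X x)] = (\sum_(a | A a) mu (X @^-1` [set a]))%E.
Proof.
move=> mX; pose s := [seq a <- enum F | A a].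
have -> : [set x | A (X x)] = \bigcup_(a in [set` s]) (X @^-1` [set a]).
  apply/seteqP; split=> [x /= Ax|x [a]]; last by rewrite /= mem_filter => /andP[+ _] Xa; rewrite -Xa.
  by exists (X x) => //=; rewrite mem_filter Ax mem_enum.
rewrite measure_fin_bigcup //; last by move=> a b _ _ [x []] /= <- <-.
have us : uniq s by apply: filter_uniq; exact: enum_uniq.
by rewrite -fsbig_seq // big_filter big_enum_cond.
Qed.

(** * Cutting the line into finitely many cells *)

Section Cells.
Variables (R : realType) (K : nat) (thr : nat -> R).
Hypothesis thr_anti : forall r r', (r <= r')%N -> thr r' <= thr r.

(** The default value is [K], taken when [y] lies below every threshold with index less than [K]. *)
Definition cell_index (y : R) : nat := find (fun r => thr r <= y) (iota 0 K).

Lemma cell_index_ltn y : (cell_index y < K.+1)%N.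
Proof. by rewrite ltnS -[X in (_ <= X)%N](size_iota 0) find_size. Qed.

Definition cell y : 'I_K.+1 := Ordinal (cell_index_ltn y).

Lemma cell_leq y r : (r < K)%N -> (cell y <= r)%N = (thr r <= y).
Proof.
move=> rK; apply/idP/idP => [h|h] /=; last first.
  rewrite leqNgt; apply/negP => /(before_find 0%N).
  by rewrite nth_iota // add0n h.
have hs : has (fun r => thr r <= y) (iota 0 K).
  by rewrite has_find size_iota (leq_ltn_trans h rK).
have := nth_find 0%N hs; rewrite nth_iota ?add0n; last by rewrite (leq_ltn_trans h rK).
exact/le_trans/thr_anti.
Qed.

Lemma measurable_cell_leq (r : nat) : measurable [set y | (cell y <= r)%N].
Proof.
have [rK|Kr] := ltnP r K.
  have -> : [set y | (cell y <= r)%N] = `[thr r, +oo[%classic.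
    by apply/seteqP; split => y /=; rewrite cell_leq // in_itv /= andbT.
  exact: measurable_itv.
have -> : [set y | (cell y <= r)%N] = setT; last exact: measurableT.
by apply/seteqP; split => // y _ /=; apply: leq_trans Kr; rewrite -ltnS cell_index_ltn.
Qed.

Lemma measurable_cell (k : 'I_K.+1) : measurable (cell @^-1` [set k]).
Proof.
have H (j : nat) : measurable [set y | cell y = j :> nat].
  case: j => [|j].
    have -> : [set y | cell y = 0%N :> nat] = [set y | (cell y <= 0)%N].
      by apply/seteqP; split => y /=; [move=> -> | rewrite leqn0 => /eqP].
    exact: measurable_cell_leq.
  have -> : [set y | cell y = j.+1 :> nat] = [set y | (cell y <= j.+1)%N] `\` [set y | (cell y <= j)%N].
    apply/seteqP; split => y /=; first by move=> ->; rewrite ltnn.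
    by move=> [h1 /negP h2]; apply/eqP; rewrite eqn_leq h1 ltnNge.
  by apply: measurableD; exact: measurable_cell_leq.
have -> : cell @^-1` [set k] = [set y | cell y = k :> nat]; last exact: H.
by apply/seteqP; split => y /=; [move=> /(congr1 val) | move=> h; apply: val_inj].
Qed.
End Cells.

(** The probability that the bound on [F_n] fails, for [v = w + n - u] and [K] the number of [r]
    with [r < n - u]. The summand [r] is the probability that [r] is the least index with at most
    [r] points in the cells up to [r]. *)
Definition crossing (R : fieldType) (n K : nat) (w v : R) : R :=
  \sum_(r < K) 'C(n, r)%:R * (abel w r / v ^+ r * ((v - w - r%:R) / v) ^+ (n - r)).

(** * From the uniform sample to a finite product law *)

Section Smirnov.
Context (R : realType) (d : measure_display) (T : measurableType d).
Variables (P : probability T R) (n : nat) (U : 'I_n -> {RV P >-> R}).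
Hypothesis indepU : mutually_independent_RV P (fun i => (U i : T -> R)).
Hypothesis unifU : forall i, uniform01_RV P (U i).
Hypothesis n0 : (0 < n)%N.

(** Replacing each [U i] by its cell leaves finitely many outcomes; by independence the mass of each
    is a product of masses [lam], so an event on cells becomes an [expect]. *)
Lemma expect_cells (K : nat) (thr : nat -> R)
    (thr_anti : forall r r', (r <= r')%N -> thr r' <= thr r)
    (Pr : pred {ffun 'I_n -> 'I_K.+1}) :
  (forall r, (r < K)%N -> 0 <= thr r <= 1) ->
  exists lam : 'I_K.+1 -> R,
  [/\ \sum_k lam k = 1,
     forall r, (r < K)%N -> \sum_k lam k * (k <= r)%N%:R = 1 - thr r &
     P [set x | Pr [ffun i => cell K thr (U i x)]] = (expect lam (fun a => (Pr a)%:R))%:E].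
Proof.
move=> thr01; pose i0 := Ordinal n0.
pose mc := measurable_cell thr_anti (K := K).
have mU i (B : set R) : measurable B -> measurable (U i @^-1` B).
  by move=> mB; rewrite -[X in measurable X]setTI; exact: measurable_funP.
pose lam k := fine (P (U i0 @^-1` (cell K thr @^-1` [set k]))).
have lamE i k : P (U i @^-1` (cell K thr @^-1` [set k])) = (lam k)%:E.
  rewrite /lam fineK; last by rewrite fin_num_measure //; apply: mU.
  by rewrite !unifU.
have lam_sum (A : pred 'I_K.+1) :
    (\sum_(k | A k) lam k)%:E = P [set x | A (cell K thr (U i0 x))].
  rewrite (measure_finite_fibers P (X := fun x => cell K thr (U i0 x))).
    by rewrite -sumEFin; apply: eq_bigr => k _; rewrite -(lamE i0).
  by move=> k; exact: (mU i0 _ (mc k)).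
exists lam; split.
- apply: EFin_inj; rewrite lam_sum -[RHS](probability_setT P); congr (P _); exact/seteqP.
- move=> r rK; apply: EFin_inj.
  transitivity (\sum_(k : 'I_K.+1 | (k <= r)%N) lam k)%:E.
    congr EFin; rewrite [RHS]big_mkcond; apply: eq_bigr => k _.
    by case: leqP; rewrite ?mulr1 ?mulr0.
  rewrite (lam_sum (fun k : 'I_K.+1 => (k <= r)%N)).
  transitivity (P (U i0 @^-1` `[thr r, +oo[%classic)).
    congr (P _); apply/seteqP; split => x /=; rewrite (cell_leq thr_anti) // in_itv /= andbT //.
  rewrite unifU //.
  have -> : `[thr r, +oo[%classic `&` `[0, 1]%classic = `[thr r, 1]%classic :> set R.
    apply/seteqP; split => y /=; rewrite !in_itv /= andbT.
      by move=> [-> /andP[_ ->]].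
    move=> /andP[h ->]; split=> //; rewrite andbT.
    by apply: le_trans h; case/andP: (thr01 _ rK).
  rewrite lebesgue_measure_itv /= lte_fin; case: ltP => // h.
  by have /andP[_ h'] := thr01 _ rK; congr EFin; apply/eqP; rewrite eq_sym subr_eq0 eq_le h h'.
have fib (a : {ffun 'I_n -> 'I_K.+1}) :
    (fun x => [ffun i => cell K thr (U i x)]) @^-1` [set a] =
    \bigcap_(i in [set: 'I_n]) (U i @^-1` (cell K thr @^-1` [set a i])).
  apply/seteqP; split => x /=; first by move=> <- i _ /=; rewrite ffunE.
  by move=> h; apply/ffunP => i; rewrite ffunE h.
have mfib (a : {ffun 'I_n -> 'I_K.+1}) :
    measurable ((fun x => [ffun i => cell K thr (U i x)]) @^-1` [set a]).
  rewrite fib; apply: fin_bigcap_measurable => // i _.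
  by apply: mU; exact: mc.
rewrite measure_finite_fibers //.
transitivity (\sum_(a | Pr a) (\prod_i lam (a i))%:E)%E.
  apply: eq_bigr => a _; rewrite fib; apply: (etrans (indepU (fun i => mc (a i)))).
  by rewrite -prodEFin; apply: eq_bigr => i _; exact: lamE.
rewrite sumEFin /expect; congr EFin; rewrite big_mkcond; apply: eq_bigr => a _.
by case: (Pr a); rewrite ?mul1r ?mul0r.
Qed.

Variables (u v w : R).
Hypotheses (u0 : 0 < u) (v0 : 0 < v) (w0 : 0 < w) (vE : v = w + n%:R - u).

(** Let [thr r] solve [v t + u = n - r]. The bound holds for all [t] iff for every integer
    [0 <= r < n - u] more than [r] sample points are at least [thr r], an event on cells to which
    [expect_stay_above] applies. *)
Lemma smirnov_formula :
  exists2 K : nat, (forall r : nat, (r < K)%N = (r%:R < n%:R - u)) &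
  P [set x | forall t : R, 0 <= t <= 1 ->
      empirical_df (fun i => (U i : T -> R)) x t <= (v * t + u) / n%:R] =
  (1 - crossing n K w v)%:E.
Proof.
have exK : exists r : nat, n%:R - u <= r%:R by exists n; rewrite gerBl ltW.
(* [K] is the least natural number at least [n - u], so the indices [r < K] are those with a
   positive threshold. *)
case: (ex_minnP exK) => K hK Kmin.
have KE (r : nat) : (r < K)%N = (r%:R < n%:R - u).
  apply/idP/idP => [rK|rn].
    by rewrite ltNge; apply/negP => /Kmin; rewrite leqNgt rK.
  rewrite ltnNge; apply/negP.
  rewrite -(ler_nat R) => h; have := le_trans hK h.
  by rewrite leNgt rn.
have Kn : (K <= n)%N by apply: Kmin; rewrite gerBl ltW.
exists K => //.
pose thr (r : nat) := 1 - (w + r%:R) / v.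
have thrE r : v * thr r = n%:R - u - r%:R.
  by rewrite /thr mulrBr mulr1 mulrC divfK ?gt_eqF // vE; ring.
have thr_anti r r' : (r <= r')%N -> thr r' <= thr r.
  by move=> rr'; rewrite -(ler_pM2l v0) !thrE lerD2l lerN2 ler_nat.
have thr_gt0 r : (r < K)%N -> 0 < thr r.
  by rewrite KE => h; rewrite -(pmulr_rgt0 _ v0) thrE subr_gt0.
have thr01 r : (r < K)%N -> 0 <= thr r <= 1.
  move=> rK; rewrite ltW ?thr_gt0 //= gerBl divr_ge0 ?ltW //.
  by rewrite ltr_wpDr.
pose Pr (a : {ffun 'I_n -> 'I_K.+1}) :=
  [forall r : 'I_K, (r < #|[set i | (a i <= r)%N]%SET|)%N].
have [lam [lam1 lamK E]] := expect_cells thr_anti Pr thr01.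
have w00 (r : nat) : w + r%:R != 0 by rewrite gt_eqF // ltr_wpDr.
have v00 : v != 0 by rewrite gt_eqF.
have lamK' r : (r < K)%N -> \sum_k lam k * (k <= r)%N%:R = (w + r%:R) / v.
  by move=> rK; rewrite lamK // /thr opprB addrC subrK.
have := @expect_stay_above R 'I_n K lam lam1 w v K w00 v00 lamK'.
rewrite card_ord -/(crossing n K w v) => /(_ (leqW Kn) (leqnSn K)) <-.
rewrite -E; congr (P _).
have n0R : 0 < n%:R :> R by rewrite ltr0n.
have empE x t : (empirical_df (fun i => (U i : T -> R)) x t <= (v * t + u) / n%:R) =
    (#|[pred i | U i x <= t]|%:R <= v * t + u).
  rewrite /empirical_df ler_pM2r ?invr_gt0 //; congr (_%:R <= _).
  apply: eq_card => i; rewrite [in RHS]inE.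
  by apply/idP/idP => [/set_mem //|h]; exact: mem_set.
have PrE x : Pr [ffun i => cell K thr (U i x)] =
    [forall r : 'I_K, (r < #|[pred i | (thr r <= U i x)%R]|)%N].
  apply: eq_forallb => r; congr (_ < _)%N; apply: eq_card => i.
  by rewrite !inE ffunE (cell_leq thr_anti).
have cardC (p : pred 'I_n) : (#|p| + #|[predC p]| = n)%N by rewrite cardC card_ord.
apply/seteqP; split => x /=; rewrite PrE.
  move=> h; apply/forallP => r; rewrite ltnNge; apply/negP => cr.
  (* At [thr r] itself the bound may hold with equality, so take the largest sample point below it,
     or [0] if there is none: at least [n - r] points are [<= t], while [v t + u < n - r]. *)
  pose t := \big[Num.max/0]_(i | U i x < thr r) U i x.
  have tlt : t < thr r by apply: bigmax_lt => //; apply: thr_gt0.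
  have t0 : 0 <= t by exact: bigmax_ge_id.
  have /andP[_ thr1] := thr01 r (ltn_ord r).
  have := h t; rewrite t0 (le_trans (ltW tlt) thr1) empE => /(_ isT).
  apply/negP; rewrite -ltNge.
  apply: (@lt_le_trans _ _ (n - r)%:R).
    rewrite natrB; last by rewrite (leq_trans _ Kn) // ltnW.
    have : v * t < v * thr r by rewrite ltr_pM2l.
    by rewrite thrE; lra.
  rewrite ler_nat leq_subLR.
  rewrite -[X in (X <= _)%N](cardC [pred i | thr r <= U i x]) leq_add //.
  apply/subset_leq_card/fintype.subsetP => i; rewrite !inE -ltNge => hi.
  by apply: le_bigmax_cond.
move=> /forallP h t /andP[t0 t1]; rewrite empE leNgt; apply/negP => ht.
(* A violation at [t] is witnessed by [r = n - j]: then [thr r > t], so at most [n - j] points reach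
   [thr r]. *)
pose j := #|[pred i | U i x <= t]|.
have jn : (j <= n)%N by rewrite -[X in (_ <= X)%N]card_ord max_card.
have jK : (n - j < K)%N.
  rewrite KE natrB // ltrD2l ltrN2; apply: le_lt_trans ht.
  by rewrite lerDr mulr_ge0 // ltW.
have := h (Ordinal jK); rewrite /= ltnNge => /negP; apply.
rewrite leq_subRL // -[X in (_ <= X)%N](cardC [pred i | U i x <= t]) leq_add2l.
apply/subset_leq_card/fintype.subsetP => i; rewrite !inE -ltNge => hi.
apply: lt_le_trans hi; rewrite -(ltr_pM2l v0) thrE natrB //.
by move: ht; rewrite -/j; lra.
Qed.
End Smirnov.

(** * The tangency equation *)

Lemma mean_value (R : realType) (f df : R -> R) (a b : R) : a < b ->
  (forall x, a <= x <= b -> is_derive x 1 f (df x)) ->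
  exists2 c, a < c < b & f b - f a = df c * (b - a).
Proof.
move=> ab fd; have [||c cab E] := @MVT R f df a b ab.
- by move=> x; rewrite in_itv /= => /andP[ax xb]; apply: fd; rewrite !ltW.
- apply: derivable_within_continuous => x; rewrite in_itv /= => /fd h.
  exact: (@ex_derive _ _ _ _ _ _ _ h).
- by exists c; rewrite // in_itv /= in cab.
Qed.

Section Tangency.
Variable R : realType.
Implicit Types c u s t m : R.

(** Chosen so that [ln (1 + c t) / t] has derivative [(1 - kap c t) / t^2]. *)
Definition kap c t : R := ln (1 + c * t) + (1 + c * t)^-1.

Lemma is_derive_affine c t : is_derive t 1 (fun t => 1 + c * t) c.
Proof.
have h := is_deriveD (is_derive_cst (1 : R) t (1 : R)) (is_deriveZ c (is_derive_id t (1 : R))).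
apply: (is_derive_eq h); rewrite add0r; exact: mulr1.
Qed.

Lemma is_derive_ln_affine c t : 0 < 1 + c * t ->
  is_derive t 1 (fun t => ln (1 + c * t)) (c / (1 + c * t)).
Proof.
move=> h; rewrite mulrC; apply: (@is_derive1_comp _ (@ln R) (fun t => 1 + c * t)).
  exact: is_derive1_ln.
exact: is_derive_affine.
Qed.

Lemma is_derive_kap c t : 0 < 1 + c * t ->
  is_derive t 1 (kap c) (t * (c / (1 + c * t)) ^+ 2).
Proof.
move=> h.
have h0 : 1 + c * t != 0 by rewrite gt_eqF.
have D := is_deriveD (is_derive_ln_affine h) (@is_deriveV _ (fun t => 1 + c * t) _ _ _ h0 (is_derive_affine c t)).
apply: (is_derive_eq D); rewrite /GRing.scale /=.
by field.
Qed.

(** The derivative of [logratio] below is [- gap / t^2], so [gap u s m = 0] says that [logratio u s]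
    is stationary at [m]. *)
Definition gap u s t : R := kap (- u) t - kap s t.

Lemma is_derive_gap u s t : u * t < 1 -> 0 < 1 + s * t ->
  is_derive t 1 (gap u s) (t * ((u / (1 - u * t)) ^+ 2 - (s / (1 + s * t)) ^+ 2)).
Proof.
move=> ut st; have ut' : 0 < 1 + - u * t by rewrite mulNr subr_gt0.
apply: (is_derive_eq (is_deriveB (is_derive_kap ut') (is_derive_kap st))).
by rewrite !mulNr sqrrN; ring.
Qed.

Lemma gap0 u s : gap u s 0 = 0.
Proof. by rewrite /gap /kap !mulr0 addr0 subrr. Qed.

(** A difference of squares; for positive [u] and [s] its sign is that of [u - s + 2 u s t], which
    is affine in [t]. *)
Lemma gap_slopeE u s t : u * t < 1 -> 0 < 1 + s * t ->
  (u / (1 - u * t)) ^+ 2 - (s / (1 + s * t)) ^+ 2 =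
  (u - s + 2 * u * s * t) / ((1 - u * t) * (1 + s * t)) *
  (u / (1 - u * t) + s / (1 + s * t)).
Proof.
move=> ut st; have h1 : 1 - u * t != 0 by rewrite gt_eqF // subr_gt0.
have h2 : 1 + s * t != 0 by rewrite gt_eqF.
by field; rewrite h1 h2.
Qed.

Lemma gap_slope_ge0 u s t : 0 < u -> 0 < s -> 0 <= t -> u * t < 1 ->
  0 <= u - s + 2 * u * s * t ->
  0 <= (u / (1 - u * t)) ^+ 2 - (s / (1 + s * t)) ^+ 2.
Proof.
move=> u0 s0 t0 ut h.
have st : 0 < 1 + s * t by rewrite ltr_pwDl // mulr_ge0 // ltW.
have ut' : 0 < 1 - u * t by rewrite subr_gt0.
rewrite gap_slopeE //; apply: mulr_ge0.
  by rewrite divr_ge0 // ltW // mulr_gt0.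
by rewrite addr_ge0 // divr_ge0 // ltW.
Qed.

Lemma gap_slope_le0 u s t : 0 < u -> 0 < s -> 0 <= t -> u * t < 1 ->
  u - s + 2 * u * s * t <= 0 ->
  (u / (1 - u * t)) ^+ 2 - (s / (1 + s * t)) ^+ 2 <= 0.
Proof.
move=> u0 s0 t0 ut h.
have st : 0 < 1 + s * t by rewrite ltr_pwDl // mulr_ge0 // ltW.
have ut' : 0 < 1 - u * t by rewrite subr_gt0.
rewrite gap_slopeE // -[X in X * _]opprK [X in X <= _]mulNr oppr_le0.
rewrite mulr_ge0 //.
  by rewrite -mulNr divr_ge0 ?oppr_ge0 // ltW // mulr_gt0.
by rewrite addr_ge0 // divr_ge0 // ltW.
Qed.

(** Intermediate value theorem in [s]. At [s = u] the slope is nonnegative on [[0, m]], so the gap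
    at [m] is too. At the upper end [b], [u - b = - 4 u^2 m] outweighs [2 u b t] for [t <= m], as
    [b <= 2 u], so the gap is nonpositive. *)
Lemma exists_tangent u m : 0 < u -> 0 < m -> 8 * (u * m) <= 1 ->
  exists2 s, u <= s <= u + 4 * (u * m) * u & gap u s m = 0.
Proof.
move=> u0 m0 um; set b := u + _.
have um0 : 0 < u * m by rewrite mulr_gt0.
have ub : u <= b by rewrite /b lerDl mulr_ge0 ?mulr_ge0 // ltW.
have b0 : 0 < b by apply: lt_le_trans ub.
have umlt : u * m < 1 by lra.
have gapu : 0 <= gap u u m.
  have [|c /andP[c0 cm] E] := @mean_value R (gap u u)
    (fun t => t * ((u / (1 - u * t)) ^+ 2 - (u / (1 + u * t)) ^+ 2)) 0 m m0.
    move=> t /andP[t0 tm]; apply: is_derive_gap.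
      by apply: le_lt_trans umlt; rewrite ler_pM2l.
    by rewrite ltr_pwDl // mulr_ge0 // ltW.
  move: E; rewrite gap0 !subr0 => ->; apply: mulr_ge0; last exact: ltW.
  apply: mulr_ge0; first exact: ltW.
  apply: gap_slope_ge0 => //; first exact: ltW.
    by apply: lt_trans umlt; rewrite ltr_pM2l.
  by rewrite subrr add0r !mulr_ge0 // ltW.
have gapb : gap u b m <= 0.
  have [|c /andP[c0 cm] E] := @mean_value R (gap u b)
    (fun t => t * ((u / (1 - u * t)) ^+ 2 - (b / (1 + b * t)) ^+ 2)) 0 m m0.
    move=> t /andP[t0 tm]; apply: is_derive_gap.
      by apply: le_lt_trans umlt; rewrite ler_pM2l.
    by rewrite ltr_pwDl // mulr_ge0 // ltW.
  move: E; rewrite gap0 !subr0 => ->.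
  apply: mulr_le0_ge0; last exact: ltW.
  apply: mulr_ge0_le0; first exact: ltW.
  apply: gap_slope_le0 => //; first exact: ltW.
    by apply: lt_trans umlt; rewrite ltr_pM2l.
  have -> : u - b + 2 * u * b * c = 2 * u * (b * c - 2 * (u * m)) by rewrite /b; ring.
  apply: mulr_ge0_le0; first by rewrite mulr_ge0 // ltW.
  rewrite subr_le0; apply/ltW.
  apply: lt_le_trans (_ : b * m <= _); first by rewrite ltr_pM2l.
  have -> : b * m = (u * m) * (1 + 4 * (u * m)) by rewrite /b; ring.
  by rewrite mulrC ler_pM2r //; lra.
have [||s sub E] := @IVT R (fun s => kap s m) u b (kap (- u) m) ub.
- apply: derivable_within_continuous => s; rewrite in_itv /= => /andP[us _].
  (* [kap] depends only on the product of its arguments, so continuity in the first follows from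
     differentiability in the second. *)
  have -> : (fun s => kap s m) = kap m by apply/funext => x; rewrite /kap mulrC.
  have D : 0 < 1 + m * s.
    by rewrite ltr_pwDl // mulr_ge0 ?(le_trans _ us) // ltW.
  exact: (@ex_derive _ _ _ _ _ _ _ (is_derive_kap D)).
- rewrite ge_min le_max; apply/andP; split; apply/orP; [left|right].
    by move: gapu; rewrite subr_ge0.
  by move: gapb; rewrite subr_le0.
exists s; first by rewrite in_itv /= in sub.
by rewrite /gap E subrr.
Qed.

(* With [t = 1/j] this is [j ln ((j - u) / (j + s))]. *)
Definition logratio u s t : R := (ln (1 + - u * t) - ln (1 + s * t)) / t.

Lemma is_derive_logratio u s t : 0 < t -> u * t < 1 -> 0 < 1 + s * t ->
  is_derive t 1 (logratio u s) (- gap u s t / t ^+ 2).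
Proof.
move=> t0 ut st.
have ut' : 0 < 1 + - u * t by rewrite mulNr subr_gt0.
have h1 : 1 + - u * t != 0 by rewrite gt_eqF.
have h2 : 1 + s * t != 0 by rewrite gt_eqF.
have h3 : t != 0 by rewrite gt_eqF.
have D := is_deriveM (is_deriveB (is_derive_ln_affine ut') (is_derive_ln_affine st))
  (@is_deriveV _ id _ _ _ h3 (is_derive_id t (1 : R))).
apply: (is_derive_eq D).
change ((ln (1 + - u * t) - ln (1 + s * t)) * (- t ^- 2 * 1) +
   t^-1 * (- u / (1 + - u * t) - s / (1 + s * t)) = - gap u s t / t ^+ 2).
rewrite /gap /kap.
by field; rewrite h3 h2.
Qed.

Variables (u s m : R).
Hypotheses (u0 : 0 < u) (us : u <= s) (m0 : 0 < m) (um : u * m < 1) (gapm : gap u s m = 0).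

Let s0 : 0 < s := lt_le_trans u0 us.

(** The gap vanishes at [0] and at [m], so by Rolle its slope vanishes at some [c] in between; the
    affine factor is zero at [c] and increases with [t]. *)
Lemma tangent_slope_ge0 t : m <= t -> 0 <= u - s + 2 * u * s * t.
Proof.
move=> mt.
have [|c /andP[c0 cm] E] := @mean_value R (gap u s)
    (fun t => t * ((u / (1 - u * t)) ^+ 2 - (s / (1 + s * t)) ^+ 2)) 0 m m0.
  move=> x /andP[x0 xm]; apply: is_derive_gap.
    by apply: le_lt_trans um; rewrite ler_pM2l.
  by rewrite ltr_pwDl // mulr_ge0 // ltW.
move: E; rewrite gap0 gapm !subr0 => /esym/eqP.
have uc : u * c < 1 by apply: lt_trans um; rewrite ltr_pM2l.
have sc : 0 < 1 + s * c by rewrite ltr_pwDl // mulr_ge0 // ltW.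
have uc' : 0 < 1 - u * c by rewrite subr_gt0.
rewrite gap_slopeE // !mulf_eq0 (gt_eqF m0) (gt_eqF c0) invr_eq0 !mulf_eq0 (gt_eqF sc) (gt_eqF uc') /=.
have -> : (u / (1 - u * c) + s / (1 + s * c) == 0) = false.
  by rewrite gt_eqF // addr_gt0 // divr_gt0.
rewrite !orbF => /eqP <-.
rewrite lerD2l ler_pM2l ?mulr_gt0 //.
exact: le_trans (ltW cm) mt.
Qed.

Lemma gap_ge0 t : m <= t -> u * t < 1 -> 0 <= gap u s t.
Proof.
rewrite le_eqVlt => /predU1P[<- _|mt ut]; first by rewrite gapm.
have [|c /andP[mc ct] E] := @mean_value R (gap u s)
    (fun t => t * ((u / (1 - u * t)) ^+ 2 - (s / (1 + s * t)) ^+ 2)) m t mt.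
  move=> x /andP[mx xt]; apply: is_derive_gap.
    by apply: le_lt_trans ut; rewrite ler_pM2l.
  by rewrite ltr_pwDl // mulr_ge0 ?(le_trans _ mx) // ltW.
move: E; rewrite gapm subr0 => ->.
have c0 : 0 < c by apply: lt_trans mc.
apply: mulr_ge0; last by rewrite subr_ge0 ltW.
apply: mulr_ge0; first exact: ltW.
apply: gap_slope_ge0 => //; first exact: ltW.
  by apply: lt_trans ut; rewrite ltr_pM2l.
exact/tangent_slope_ge0/ltW.
Qed.

(** The derivative [- gap / t^2] is nonpositive to the right of [m]. With [m = 1/n] and [t = 1/j],
    the ratio of the terms is largest at [j = n]. *)
Lemma logratio_le t : m <= t -> u * t < 1 -> logratio u s t <= logratio u s m.
Proof.
rewrite le_eqVlt => /predU1P[<- //|mt ut].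
have [|c /andP[mc ct] E] := @mean_value R (logratio u s)
    (fun t => - gap u s t / t ^+ 2) m t mt.
  move=> x /andP[mx xt]; have x0 : 0 < x by apply: lt_le_trans mx.
  apply: is_derive_logratio => //.
    by apply: le_lt_trans ut; rewrite ler_pM2l.
  by rewrite ltr_pwDl // mulr_ge0 // ltW.
rewrite -subr_le0 E mulNr mulNr oppr_le0.
apply: mulr_ge0; last by rewrite subr_ge0 ltW.
apply: divr_ge0; last exact: sqr_ge0.
apply: gap_ge0; first exact: ltW.
by apply: lt_trans ut; rewrite ltr_pM2l.
Qed.

(** By [gap_slopeE] the derivative of the gap at [c] is at most [c * 8 u^2 c * 4 u]; the mean value
    theorem is applied from the zero at [m]. *)
Lemma gap_le t : s <= 2 * u -> m <= t -> 2 * (u * t) <= 1 ->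
  gap u s t <= 32 * u ^+ 3 * t ^+ 2 * (t - m).
Proof.
move=> s2; rewrite le_eqVlt => /predU1P[<- _|mt ut]; first by rewrite gapm subrr mulr0.
have [|c /andP[mc ct] E] := @mean_value R (gap u s)
    (fun t => t * ((u / (1 - u * t)) ^+ 2 - (s / (1 + s * t)) ^+ 2)) m t mt.
  move=> x /andP[mx xt]; apply: is_derive_gap.
    apply: (@le_lt_trans _ _ (u * t)); last by lra.
    by rewrite ler_pM2l.
  by rewrite ltr_pwDl // mulr_ge0 ?(le_trans _ mx) // ltW.
move: E; rewrite gapm subr0 => ->.
have c0 : 0 < c by apply: lt_trans mc.
have uct : u * c < u * t by rewrite ltr_pM2l.
have uc : u * c < 1 by lra.
have uc' : 1 <= 2 * (1 - u * c) by lra.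
have uc'' : 0 < 1 - u * c by lra.
have sc0 : 0 < s * c by rewrite mulr_gt0.
have sc : 0 < 1 + s * c by lra.
rewrite ler_wpM2r ?subr_ge0 ?(ltW mt) //.
have A : u / (1 - u * c) <= 2 * u.
  rewrite ler_pdivrMr // mulrAC -[X in X <= _]mul1r ler_wpM2r //; exact: ltW.
have B : s / (1 + s * c) <= 2 * u.
  rewrite ler_pdivrMr //; apply: le_trans s2 _.
  by rewrite ler_peMr ?mulr_ge0 ?ltW //; lra.
have D : (u - s + 2 * u * s * c) / ((1 - u * c) * (1 + s * c)) <= 8 * u ^+ 2 * c.
  rewrite ler_pdivrMr ?mulr_gt0 //.
  apply: (@le_trans _ _ (4 * u ^+ 2 * c)).
    have : u * c * s <= u * c * (2 * u) by rewrite ler_pM2l // mulr_gt0.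
    have -> : 4 * u ^+ 2 * c = 2 * (u * c * (2 * u)) by ring.
    have -> : 2 * u * s * c = 2 * (u * c * s) by ring.
    by have := us; move: (u * c * s) (u * c * (2 * u)) => x y; lra.
  have h : 1 <= 2 * ((1 - u * c) * (1 + s * c)).
    rewrite mulrA; apply: le_trans uc' _; rewrite ler_peMr ?mulr_ge0 ?(ltW uc'') //; lra.
  have h4 : 0 <= 4 * u ^+ 2 * c by rewrite !mulr_ge0 ?sqr_ge0 // ltW.
  by have := ler_wpM2l h4 h; lra.
rewrite gap_slopeE //.
have D0 : 0 <= (u - s + 2 * u * s * c) / ((1 - u * c) * (1 + s * c)).
  rewrite divr_ge0 ?mulr_ge0 ?(ltW uc'') ?(ltW sc) //.
  exact/tangent_slope_ge0/ltW.
apply: (@le_trans _ _ (c * (8 * u ^+ 2 * c * (4 * u)))).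
  rewrite ler_pM2l // ler_pM //.
    by rewrite addr_ge0 ?divr_ge0 ?ltW.
  by lra.
have -> : c * (8 * u ^+ 2 * c * (4 * u)) = 32 * u ^+ 3 * c ^+ 2 by ring.
rewrite ler_pM2l; last by rewrite mulr_gt0 // exprn_gt0.
by rewrite ler_sqr ?nnegrE ?ltW // (lt_trans c0).
Qed.

(** Tangency removes the first-order term: the derivative is at least [- 32 u^3 (t - m)], hence the
    loss is quadratic. *)
Lemma logratio_ge t : s <= 2 * u -> m <= t -> 2 * (u * t) <= 1 ->
  logratio u s m - logratio u s t <= 32 * u ^+ 3 * (t - m) ^+ 2.
Proof.
move=> s2; rewrite le_eqVlt => /predU1P[<- _|mt ut].
  by rewrite !subrr expr0n mulr0.
have [|c /andP[mc ct] E] := @mean_value R (logratio u s)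
    (fun t => - gap u s t / t ^+ 2) m t mt.
  move=> x /andP[mx xt]; have x0 : 0 < x by apply: lt_le_trans mx.
  apply: is_derive_logratio => //.
    apply: (@le_lt_trans _ _ (u * t)); last by lra.
    by rewrite ler_pM2l.
  by rewrite ltr_pwDl // mulr_ge0 // ltW.
have c0 : 0 < c by apply: lt_trans mc.
have uct : u * c < u * t by rewrite ltr_pM2l.
rewrite -opprB E !mulNr opprK.
have -> : 32 * u ^+ 3 * (t - m) ^+ 2 = 32 * u ^+ 3 * (t - m) * (t - m) by ring.
rewrite ler_wpM2r ?subr_ge0 ?(ltW mt) //.
rewrite ler_pdivrMr ?exprn_gt0 //.
have ucl : 2 * (u * c) <= 1 by lra.
apply: le_trans (gap_le s2 (ltW mc) ucl) _.
rewrite [X in _ <= X]mulrAC ler_pM2l; last by rewrite !mulr_gt0 ?exprn_gt0.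
by rewrite lerD2r ltW.
Qed.
End Tangency.

(** * Asymptotics of the crossing probability *)

Section AbelLaw.
Variable R : realType.
Variables (n : nat) (w s : R).
Hypotheses (w0 : 0 < w) (s0 : 0 < s).

(** The terms of [abel_identity] at [y = s], normalised: those of [crossing] with [- u] replaced by
    [s > 0], so that all of them up to [r = n] are nonnegative. *)
Definition abel_law (r : nat) : R :=
  'C(n, r)%:R * (abel w r * (s + n%:R - r%:R) ^+ (n - r)) / (w + s + n%:R) ^+ n.

Lemma abel_ge0 r : 0 <= abel w r.
Proof. by rewrite /abel divr_ge0 ?mulr_ge0 ?exprn_ge0 ?addr_ge0 // ltW. Qed.

Lemma abel_law_ge0 r : (r <= n)%N -> 0 <= abel_law r.
Proof.
move=> rn; have X0 : 0 <= w + s + n%:R by rewrite !addr_ge0 // ltW.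
have Y0 : 0 <= s + n%:R - r%:R by rewrite -addrA addr_ge0 ?(ltW s0) // subr_ge0 ler_nat.
apply: divr_ge0; last exact: exprn_ge0.
apply: mulr_ge0 => //; apply: mulr_ge0; first exact: abel_ge0.
exact: exprn_ge0.
Qed.

Let nz (x : R) : 0 < x -> forall r : nat, x + r%:R != 0.
Proof. by move=> x0 r; rewrite gt_eqF // ltr_wpDr. Qed.

Let X0 : w + s + n%:R != 0 := nz (addr_gt0 w0 s0) n.

Lemma abel_law_sum : \sum_(r < n.+1) abel_law r = 1.
Proof.
rewrite -mulr_suml abel_identity; last exact: nz.
by rewrite divff // expf_neq0.
Qed.

Let jE (r : 'I_n.+1) : s + n%:R - r%:R = s + (n - r)%:R.
Proof. by rewrite natrB ?addrA // -ltnS. Qed.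

(** The factor [s / (s + j)], [j = n - r], turns [(s + j)^j] into [abel s j], and [abel_convolution]
    applies; its square will call for [abel_convolution2]. *)
Lemma abel_law_mean :
  \sum_(r < n.+1) abel_law r * (s / (s + n%:R - r%:R)) = (w + s) / (w + s + n%:R).
Proof.
transitivity (abel (w + s) n / (w + s + n%:R) ^+ n); last first.
  rewrite /abel; set X := w + s + n%:R.
  by rewrite mulrAC mulfK // expf_neq0.
rewrite -abel_convolution; [|exact: nz|exact: nz|exact: X0].
rewrite mulr_suml; apply: eq_bigr => r _.
by rewrite /abel_law jE /(abel s); ring.
Qed.

Lemma abel_law_mean2 : (0 < n)%N ->
  \sum_(r < n.+1) abel_law r * (s / (s + n%:R - r%:R)) ^+ 2 =
  (w + s) / (w + s + n%:R) -
    s * n%:R * (w + s + 1) / ((s + 1) * (w + s + n%:R) ^+ 2).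
Proof.
move=> n0; have s1 : s + 1 != 0 by exact: (nz s0 1).
apply: (mulfI s1).
transitivity (((s + 1) * abel (w + s) n - s * (n%:R * abel (w + s + 1) n.-1)) /
  (w + s + n%:R) ^+ n).
  rewrite -abel_convolution2; [|exact: nz|exact: nz|exact: (nz (addr_gt0 w0 s0))].
  rewrite -mulrA mulr_suml; congr (_ * _); apply: eq_bigr => r _.
  by rewrite /abel_law jE expr_div_n; ring.
rewrite /abel; have := X0.
have -> : w + s + 1 + n.-1%:R = w + s + n%:R.
  by rewrite -{2}(prednK n0) -natr1; ring.
move: (w + s + n%:R) => X hX.
have -> : X ^+ n = X * X ^+ n.-1 by rewrite -exprS prednK.
have hXn : X ^+ n.-1 != 0 by rewrite expf_neq0.
by field; rewrite hXn hX s1.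
Qed.

(** The second moment about the value at [r = 0]: the first term is the variance, the second the
    squared distance from the mean to [s / (s + n)]. *)
Lemma abel_law_variance : (0 < n)%N ->
  \sum_(r < n.+1) abel_law r * (s / (s + n%:R - r%:R) - s / (s + n%:R)) ^+ 2 =
  n%:R * w / ((s + 1) * (w + s + n%:R) ^+ 2) +
  (n%:R * w / ((w + s + n%:R) * (s + n%:R))) ^+ 2.
Proof.
move=> n0; set c := s / (s + n%:R).
transitivity (\sum_(r < n.+1) (abel_law r * (s / (s + n%:R - r%:R)) ^+ 2 -
   2 * c * (abel_law r * (s / (s + n%:R - r%:R))) + c ^+ 2 * abel_law r)).
  by apply: eq_bigr => r _; ring.
rewrite big_split sumrB -!mulr_sumr /= abel_law_sum abel_law_mean abel_law_mean2 // /c.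
have h1 : s + n%:R != 0 := nz s0 n.
have h2 : s + 1 != 0 := nz s0 1.
by field; rewrite h1 h2 X0.
Qed.
End AbelLaw.

(** * Comparison with the exponential *)

Section Estimates.
Variable R : realType.
Implicit Types u s w N : R.

Lemma expR_logratio u s (j : nat) : u < j%:R -> 0 < u -> 0 < s ->
  expR (logratio u s j%:R^-1) = ((j%:R - u) / (j%:R + s)) ^+ j.
Proof.
move=> uj u0 s0; have j0 : 0 < j%:R :> R by apply: lt_trans uj.
rewrite /logratio invrK expRM_natr; congr (_ ^+ _).
have h1 : 0 < 1 + - u * j%:R^-1 by rewrite mulNr subr_gt0 ltr_pdivrMr // mul1r.
have h2 : 0 < 1 + s * j%:R^-1 by rewrite addr_gt0 // divr_gt0.
rewrite expRD expRN !lnK ?posrE //.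
have h3 : j%:R != 0 :> R by rewrite gt_eqF.
have h4 : j%:R + s != 0 by rewrite gt_eqF // addr_gt0.
by field; rewrite h3 h4.
Qed.

Lemma mul_expRN_le1 (x : R) : x * expR (- x) <= 1.
Proof.
rewrite expRN ler_pdivrMr ?expR_gt0 // mul1r.
by apply: le_trans (expR_ge1Dx x); rewrite lerDr.
Qed.

Lemma expR_diff_le (a b : R) : a <= b -> expR (- a) - expR (- b) <= (b - a) * expR (- a).
Proof.
move=> ab; have := expR_ge1Dx (- (b - a)).
have -> : - b = - a + - (b - a) by ring.
rewrite expRD; move: (expR_gt0 (- a)) => E0 h.
rewrite -[X in X - _]mulr1 -mulrBr mulrC ler_pM2r //; lra.
Qed.

(** With [x = u/n], [y = w/n], [z = s/n], the base is [1 - y (x + z) / ((1 + z) (1 + y - x))] and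
    its inverse is [1 + y (x + z) / ((1 - x) (1 + y + z))]. As [x + z] is close to [2 x], applying
    [1 + t <= exp t] to each gives the two bounds. *)
Lemma rho_bounds (n : nat) u s w : (0 < n)%N -> 0 < u -> 0 < w ->
  8 * (u + w) <= n%:R -> u <= s <= u + 4 * (u / n%:R) * u ->
  expR (- (2 * u * w / n%:R * (1 + 5 * ((u + w) / n%:R)))) <=
    ((n%:R - u) * (w + s + n%:R) / ((n%:R + s) * (w + n%:R - u))) ^+ n <=
  expR (- (2 * u * w / n%:R * (1 - 2 * ((u + w) / n%:R)))).
Proof.
move=> n0 u0 w0 h8 /andP[us s4].
set rho := _ ^+ n; set A := 2 * u * w / n%:R; set eta := (u + w) / n%:R.
have N0 : 0 < n%:R :> R by rewrite ltr0n.
pose N : R := n%:R; rewrite -/N in N0 h8 s4 rho A eta *.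
pose x := u / N; pose y := w / N; pose z := s / N.
have x0 : 0 < x by rewrite divr_gt0.
have y0 : 0 < y by rewrite divr_gt0.
have uE : u = x * N by rewrite divfK // gt_eqF.
have wE : w = y * N by rewrite divfK // gt_eqF.
have sE : s = z * N by rewrite divfK // gt_eqF.
have xz : x <= z by rewrite ler_pM2r // invr_gt0.
have xy8 : 8 * (x + y) <= 1.
  rewrite -(ler_pM2r N0); move: h8; rewrite {1}uE {1}wE => h8.
  by lra.
have z4 : z <= x + 4 * x ^+ 2.
  rewrite -(ler_pM2r N0) -sE; apply: le_trans s4 _.
  have -> : (x + 4 * x ^+ 2) * N = x * N + 4 * x * (x * N) by ring.
  by rewrite -uE.
have etaE : eta = x + y by rewrite /eta mulrDl.
have AE : A = 2 * x * y * N.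
  by rewrite /A uE wE; field; rewrite gt_eqF.
clearbody x y z.
have a0 : 0 < 1 - x by lra.
have b0 : 0 < 1 + z by lra.
have c0 : 0 < y + 1 - x by lra.
have d0 : 0 < y + z + 1 by lra.
have rhoE : rho = ((1 - x) * (y + z + 1) / ((1 + z) * (y + 1 - x))) ^+ n.
  rewrite /rho uE wE sE; congr (_ ^+ _).
  have h1 : 1 + z != 0 by rewrite gt_eqF.
  have h2 : y + 1 - x != 0 by rewrite gt_eqF.
  have h3 : N != 0 by rewrite gt_eqF.
  have -> : y * N + N - x * N = N * (y + 1 - x) by ring.
  have -> : N + z * N = N * (1 + z) by ring.
  by field; rewrite h1 h2 h3.
have base0 : 0 < (1 - x) * (y + z + 1) / ((1 + z) * (y + 1 - x)).
  by rewrite divr_gt0 // mulr_gt0.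
have x2 : 0 <= x ^+ 2 by apply: sqr_ge0.
have zx : z <= 2 * x by rewrite expr2 in z4 x2; nra.
rewrite rhoE AE etaE; apply/andP; split.
  have -> : - (2 * x * y * N * (1 + 5 * (x + y))) = (- (2 * x * y * (1 + 5 * (x + y)))) * n%:R.
    by rewrite -/N; ring.
  rewrite expRM_natr ler_pXn2r ?nnegrE ?expR_ge0 ?(ltW base0) //.
  rewrite expRN -[X in _ <= X]invrK lef_pV2 ?posrE ?invr_gt0 ?expR_gt0 //.
  apply: le_trans (expR_ge1Dx _).
  rewrite invf_div ler_pdivrMr ?mulr_gt0 //.
  have -> : (1 + z) * (y + 1 - x) = (1 - x) * (y + z + 1) + y * (x + z) by ring.
  rewrite [X in _ <= X]mulrDl mul1r lerD2l.
  have -> : 2 * x * y * (1 + 5 * (x + y)) * ((1 - x) * (y + z + 1)) =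
     y * (2 * x * ((1 + 5 * (x + y)) * (1 - x) * (y + z + 1))) by ring.
  rewrite ler_pM2l //; apply: (@le_trans _ _ (2 * x * (1 + 2 * x))).
    by rewrite expr2 in z4; lra.
  rewrite ler_pM2l ?mulr_gt0 //; apply: (@le_trans _ _ ((1 + 5 * (x + y)) * (1 - x))).
    have -> : (1 + 5 * (x + y)) * (1 - x) = 1 + 2 * x + x * (2 - 5 * x) + 5 * y * (1 - x) by ring.
    rewrite -addrA lerDl addr_ge0 // mulr_ge0 //; lra.
  by rewrite ler_peMr ?mulr_ge0 //; lra.
have -> : - (2 * x * y * N * (1 - 2 * (x + y))) = (- (2 * x * y * (1 - 2 * (x + y)))) * n%:R.
  by rewrite -/N; ring.
rewrite expRM_natr ler_pXn2r ?nnegrE ?expR_ge0 ?(ltW base0) //.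
apply: le_trans (expR_ge1Dx _).
rewrite ler_pdivrMr ?mulr_gt0 //.
have -> : (1 - x) * (y + z + 1) = (1 + z) * (y + 1 - x) - y * (x + z) by ring.
rewrite addrC -lerBrDr [X in _ <= X - _]mulrDl mul1r addrAC subrr add0r mulNr lerN2.
have -> : 2 * x * y * (1 - 2 * (x + y)) * ((1 + z) * (y + 1 - x)) =
   y * (2 * x * ((1 - 2 * (x + y)) * ((1 + z) * (y + 1 - x)))) by ring.
rewrite ler_pM2l //; apply: (@le_trans _ _ (2 * x)); last by lra.
rewrite ler_piMr ?mulr_ge0 ?(ltW x0) //.
apply: (@le_trans _ _ ((1 - 2 * (x + y)) * (1 + 2 * (x + y)))).
  rewrite ler_wpM2l //; first by lra.
  apply: (@le_trans _ _ ((1 + 2 * x) * (1 + y))).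
    by apply: ler_pM; lra.
  by nra.
have := sqr_ge0 (x + y); rewrite expr2; lra.
Qed.
End Estimates.

(** * Ratio of the crossing terms to the Abel law *)

Section Ratio.
Variables (R : realType) (n : nat) (u s : R).
Hypotheses (n0 : (0 < n)%N) (u1 : 1 <= u) (un : 8 * u <= n%:R).
Hypotheses (us : u <= s) (s2 : s <= 2 * u) (tangent : gap u s n%:R^-1 = 0).

Let u0 : 0 < u := lt_le_trans ltr01 u1.
Let s0 : 0 < s := lt_le_trans u0 us.
Let N0 : 0 < n%:R :> R. Proof. by rewrite ltr0n. Qed.
Let m0 : 0 < n%:R^-1 :> R. Proof. by rewrite invr_gt0. Qed.
Let ultn : u < n%:R. Proof. by have := u0; have := un; lra. Qed.
Let um : u * n%:R^-1 < 1. Proof. by rewrite ltr_pdivrMr // mul1r ultn. Qed.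

(** With [j = n - r], the quotient of the crossing term by the term of the law, divided by its value
    at [j = n]. *)
Definition ratio (j : nat) : R :=
  ((j%:R - u) / (j%:R + s)) ^+ j / ((n%:R - u) / (n%:R + s)) ^+ n.

Lemma ratioE j : u < j%:R ->
  ratio j = expR (- (logratio u s n%:R^-1 - logratio u s j%:R^-1)).
Proof. by move=> uj; rewrite /ratio -!expR_logratio // opprB expRD expRN. Qed.

Let inv_le (j : nat) : (j <= n)%N -> u < j%:R -> n%:R^-1 <= j%:R^-1 :> R.
Proof.
move=> jn uj; rewrite lef_pV2 ?posrE //; first by rewrite ler_nat.
exact: lt_trans uj.
Qed.

Lemma ratio_le1 j : (j <= n)%N -> u < j%:R -> ratio j <= 1.
Proof.
move=> jn uj; have j0 : 0 < j%:R :> R by apply: lt_trans uj.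
rewrite ratioE // -[X in _ <= X]expR0 ler_expR oppr_le0 subr_ge0.
apply: (logratio_le u0 us m0 um tangent); first exact: inv_le.
by rewrite ltr_pdivrMr // mul1r.
Qed.

(** A majorant of [1 - ratio j] for [u < j <= n], in terms of [s / (s + j)], whose moments are
    explicit. The constant is [32 * 4^2]: [32] from [logratio_ge], [4] from comparing [1/j - 1/n]
    with [1/(s + j) - 1/(s + n)]. *)
Definition defect (j : nat) : R := 512 * s * (s / (s + j%:R) - s / (s + n%:R)) ^+ 2.

(** The two fractions differ by at least [1/20], and [512 / 400 > 1]. This covers [j <= u], where
    there is no crossing term, and the [j] too small for [logratio_ge]. *)
Lemma defect_small j : j%:R <= 2 * u -> 1 <= defect j.
Proof.
move=> j2; have j0 : 0 <= j%:R :> R by [].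
have A : 1 / 4 <= s / (s + j%:R).
  rewrite ler_pdivlMr; last by rewrite ltr_wpDr.
  by have := us; lra.
have B : s / (s + n%:R) <= 1 / 5.
  rewrite ler_pdivrMr; last by rewrite addr_gt0.
  by have := s2; have := un; lra.
rewrite /defect; set d := _ - _.
have d0 : 1 / 20 <= d by rewrite /d; lra.
have d2 : (1 / 20) ^+ 2 <= d ^+ 2 by rewrite ler_sqr ?nnegrE //; lra.
have s1 : 1 <= s by apply: le_trans us.
have := ler_pM (ler01 : 0 <= 1 :> R) (sqr_ge0 _) s1 d2.
by move: (d ^+ 2) => e; rewrite -mulrA expr2; lra.
Qed.

Lemma ratio_ge j : (j <= n)%N -> u < j%:R -> 1 - defect j <= ratio j.
Proof.
move=> jn uj; have j0 : 0 < j%:R :> R by apply: lt_trans uj.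
have jnR : j%:R <= n%:R :> R by rewrite ler_nat.
have [j2|j2] := leP (j%:R) (2 * u).
  apply: (@le_trans _ _ 0); first by rewrite subr_le0 defect_small.
  by rewrite ratioE // expR_ge0.
rewrite ratioE //; apply: le_trans (expR_ge1Dx _).
rewrite lerD2l lerN2; apply: (@le_trans _ _ (32 * u ^+ 3 * (j%:R^-1 - n%:R^-1) ^+ 2)).
  apply: (logratio_ge u0 us m0 um tangent s2); first exact: inv_le.
  by rewrite mulrA ler_pdivrMr // mul1r ltW.
pose a : R := j%:R^-1 - n%:R^-1; pose b : R := (s + j%:R)^-1 - (s + n%:R)^-1.
have -> : defect j = 512 * s ^+ 3 * b ^+ 2 by rewrite /defect /b; ring.
have a0 : 0 <= a by rewrite subr_ge0 inv_le.
(* Here [s <= 2 u < j <= n], so [s + j <= 2 j] and [s + n <= 2 n]. *)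
have ab : a <= 4 * b.
  have sj : 0 < s + j%:R by rewrite addr_gt0.
  have sn : 0 < s + n%:R by rewrite addr_gt0.
  have -> : a = (n%:R - j%:R) / (j%:R * n%:R).
    by rewrite /a; field; rewrite !gt_eqF.
  have -> : 4 * b = (n%:R - j%:R) * (4 / ((s + j%:R) * (s + n%:R))).
    by rewrite /b; field; rewrite !gt_eqF.
  rewrite ler_wpM2l ?subr_ge0 // ler_pdivlMr ?mulr_gt0 // mulrC ler_pdivrMr ?mulr_gt0 //.
  apply: (@le_trans _ _ ((2 * j%:R) * (2 * n%:R))); last by lra.
  by apply: ler_pM; rewrite ?addr_ge0 ?(ltW s0) //; have := s2; have := un; lra.
have u3 : u ^+ 3 <= s ^+ 3 by rewrite lerXn2r ?nnegrE // ltW.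
have a2 : a ^+ 2 <= (4 * b) ^+ 2.
  by rewrite ler_sqr ?nnegrE //; apply: le_trans ab.
have := ler_pM (exprn_ge0 3 (ltW u0)) (sqr_ge0 a) u3 a2.
rewrite exprMn -/a; move: (u ^+ 3) (s ^+ 3) (a ^+ 2) (b ^+ 2) => U S x y h.
have -> : 32 * U * x = 32 * (U * x) by ring.
have -> : 512 * S * y = 32 * (S * (4 ^+ 2 * y)) by ring.
by rewrite ler_pM2l.
Qed.

End Ratio.

(** * Upper and lower bounds for the crossing probability *)

Section Crossing.
Variables (R : realType) (n K : nat) (u w : R).
Hypotheses (n0 : (0 < n)%N) (u0 : 0 < u) (w0 : 0 < w) (n8 : 8 * (u + w) <= n%:R).
Hypothesis KE : forall r : nat, (r < K)%N = (r%:R < n%:R - u).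

Let N0 : 0 < n%:R :> R. Proof. by rewrite ltr0n. Qed.
Let v := w + n%:R - u.
Let v0 : 0 < v. Proof. by rewrite /v; have := u0; have := w0; have := n8; lra. Qed.
Let nz (x : R) : 0 < x -> forall r : nat, x + r%:R != 0.
Proof. by move=> x0 r; rewrite gt_eqF // ltr_wpDr. Qed.

Let Kn : (K <= n)%N.
Proof. by rewrite leqNgt KE ltNge gerBl ltW. Qed.

Lemma crossing_termE r : (r <= n)%N ->
  'C(n, r)%:R * (abel w r / v ^+ r * ((v - w - r%:R) / v) ^+ (n - r)) =
  'C(n, r)%:R * (abel w r * (- u + n%:R - r%:R) ^+ (n - r)) / v ^+ n.
Proof.
move=> rn; have -> : v ^+ n = v ^+ r * v ^+ (n - r) by rewrite -exprD subnKC.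
have -> : v - w - r%:R = - u + n%:R - r%:R by rewrite /v; ring.
by rewrite expr_div_n invfM; ring.
Qed.

(** Here [K = n], so only the term [r = n] is missing from the complete Abel sum. It equals
    [w / (w + n) * (1 + u/v)^n], and [(1 + u/v)^n <= exp (n u / v) <= exp 2 <= 16] as [v >= n/2]. *)
Lemma crossing_small_u : u < 1 ->
  1 - 16 * (w / n%:R) <= crossing n K w v <= 1.
Proof.
move=> u1; have KnE : K = n.
  apply/eqP; rewrite eqn_leq Kn /=.
  have e : n%:R = n.-1%:R + 1 :> R by rewrite natr1 prednK.
  by have := KE n.-1; rewrite prednK // => ->; lra.
have -> : crossing n K w v = 1 - abel w n / v ^+ n.
  have := abel_identity n (- u) (nz w0).
  rewrite big_ord_recr /= subnn expr0 mulr1 binn mul1r.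
  have -> : w + - u + n%:R = v by rewrite /v; ring.
  move=> /(congr1 (fun x => x / v ^+ n)); rewrite divff ?expf_neq0 ?gt_eqF // => <-.
  rewrite mulrDl addrK mulr_suml /crossing KnE; apply: eq_bigr => r _.
  by rewrite crossing_termE // ltnW.
have q0 : 0 <= abel w n / v ^+ n by rewrite divr_ge0 ?abel_ge0 // exprn_ge0 // ltW.
apply/andP; split; last by rewrite gerBl.
rewrite lerD2l lerN2.
have wn0 : 0 < w + n%:R by rewrite addr_gt0.
have -> : abel w n / v ^+ n = w / (w + n%:R) * (1 + u / v) ^+ n.
  have -> : 1 + u / v = (w + n%:R) / v.
    by rewrite -{1}(divff (lt0r_neq0 v0)) -mulrDl /v; congr (_ / _); ring.
  by rewrite /abel expr_div_n; ring.
rewrite [X in _ <= X]mulrC; apply: ler_pM.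
- by rewrite divr_ge0 // ltW.
- by rewrite exprn_ge0 // addr_ge0 // divr_ge0 // ltW.
- by rewrite ler_pM2l // lef_pV2 ?posrE // lerDr ltW.
apply: (@le_trans _ _ (expR (2^-1 * 4%:R))).
  apply: (@le_trans _ _ (expR (u / v * n%:R))).
    rewrite expRM_natr lerXn2r ?nnegrE ?expR_ge0 //.
      by rewrite addr_ge0 // divr_ge0 // ltW.
    exact: expR_ge1Dx.
  rewrite ler_expR mulrAC ler_pdivrMr //.
  have -> : 2^-1 * 4%:R * v = 2 * v :> R by field.
  have : u * n%:R <= 1 * n%:R by rewrite ler_pM2r // ltW.
  by rewrite /v; have := n8; have := u0; have := w0; lra.
rewrite expRM_natr.
have e2 : expR 2^-1 <= 2 :> R.
  rewrite -[2^-1]opprK expRN -[X in _ <= X]invrK lef_pV2 ?posrE ?expR_gt0 //.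
  by apply: le_trans (expR_ge1Dx _); lra.
apply: le_trans (_ : 2 ^+ 4 <= _); first by rewrite lerXn2r ?nnegrE ?expR_ge0.
by lra.
Qed.

Variable s : R.
Hypotheses (u1 : 1 <= u) (us : u <= s) (s4 : s <= u + 4 * (u / n%:R) * u).
Hypothesis tangent : gap u s n%:R^-1 = 0.

Let s0 : 0 < s := lt_le_trans u0 us.
Let un8 : 8 * u <= n%:R. Proof. by have := n8; have := w0; lra. Qed.
Let s2 : s <= 2 * u.
Proof.
apply: le_trans s4 _; have : 4 * (u / n%:R) <= 1.
  by rewrite mulrA ler_pdivrMr //; have := un8; have := u0; lra.
by rewrite -(ler_pM2r u0); lra.
Qed.

(** The quotient of the crossing term by the term of the Abel law at [r = 0]. *)
Let rho := ((n%:R - u) * (w + s + n%:R) / ((n%:R + s) * (w + n%:R - u))) ^+ n.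

Let rho_gt0 : 0 < rho.
Proof.
apply: exprn_gt0; apply: divr_gt0; apply: mulr_gt0 => //.
- by have := un8; have := u0; lra.
- by rewrite !addr_gt0.
- by rewrite addr_gt0.
Qed.

Lemma crossing_ratio : crossing n K w v =
  rho * \sum_(r < K) abel_law n w s r * ratio n u s (n - r).
Proof.
rewrite mulr_sumr; apply: eq_bigr => r _.
have rK : r%:R < n%:R - u by rewrite -KE.
have rn : (r <= n)%N by rewrite (leq_trans _ Kn) // ltnW.
rewrite crossing_termE //.
rewrite /rho /abel_law /ratio !expr_div_n !exprMn natrB // -/v.
have -> : - u + n%:R - r%:R = n%:R - r%:R - u by ring.
have -> : n%:R - r%:R + s = s + n%:R - r%:R by ring.
have h1 : (s + n%:R - r%:R) ^+ (n - r) != 0.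
  by rewrite expf_neq0 // gt_eqF //; have := s0; have := u0; lra.
have h2 : (n%:R + s) ^+ n != 0 by rewrite expf_neq0 // gt_eqF // addr_gt0.
have h3 : (n%:R - u) ^+ n != 0.
  by rewrite expf_neq0 // gt_eqF //; have := un8; have := u0; lra.
have h4 : (w + s + n%:R) ^+ n != 0 by rewrite expf_neq0 // gt_eqF // !addr_gt0.
have h5 : v ^+ n != 0 by rewrite expf_neq0 // gt_eqF.
move: h1 h2 h3 h4 h5.
move: ((s + _ - _) ^+ _) ((_ + s) ^+ n) ((_ - u) ^+ n) ((w + s + _) ^+ n) (v ^+ n) ((_ - _ - u) ^+ (n - r)).
move=> x1 x2 x3 x4 x5 x6 h1 h2 h3 h4 h5.
by field; rewrite h1 h2 h3 h4 h5.
Qed.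

Lemma crossing_le : crossing n K w v <= rho.
Proof.
rewrite crossing_ratio ler_piMr ?(ltW rho_gt0) //.
rewrite -(abel_law_sum n w0 s0) -(big_mkord xpredT (abel_law n w s)) (@big_cat_nat _ _ _ K) //=; last exact: leqW.
apply: ler_wpDr.
  rewrite big_nat_cond; apply: sumr_ge0 => r /andP[/andP[_ rn] _].
  by apply: abel_law_ge0.
rewrite big_mkord; apply: ler_sum => r _.
have rK : r%:R < n%:R - u by rewrite -KE.
have rn : (r <= n)%N by rewrite (leq_trans _ Kn) // ltnW.
rewrite ler_piMr ?abel_law_ge0 //; apply: ratio_le1 => //; first exact: leq_subr.
by rewrite natrB //; lra.
Qed.

(** Bound the ratio below by [1 - defect]. For [r >= K], where [j <= u], this is nonpositive, so the
    sum may be extended to the whole law and [abel_law_variance] evaluates it. Multiplied by [s],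
    the variance contributes at most [w/n] and the squared bias at most [2 u (w/n)^2]. *)
Lemma crossing_ge : rho * (1 - 512 * (w / n%:R) * (1 + 2 * u * w / n%:R)) <= crossing n K w v.
Proof.
rewrite crossing_ratio ler_pM2l //.
apply: (@le_trans _ _ (\sum_(r < n.+1) abel_law n w s r * (1 - defect n s (n - r)))).
  have -> : \sum_(r < n.+1) abel_law n w s r * (1 - defect n s (n - r)) =
    1 - 512 * s * \sum_(r < n.+1) abel_law n w s r *
      (s / (s + n%:R - r%:R) - s / (s + n%:R)) ^+ 2.
    rewrite -[X in X - _](abel_law_sum n w0 s0) mulr_sumr -sumrB; apply: eq_bigr => r _.
    rewrite /defect natrB ?addrA; last by rewrite -ltnS.
    by ring.
  rewrite abel_law_variance // lerD2l lerN2.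
  set X := w + s + n%:R.
  have NX : n%:R <= X by rewrite lerDr addr_ge0 ?ltW.
  have X0 : 0 < X := lt_le_trans N0 NX.
  have sn : n%:R <= s + n%:R by rewrite lerDr ltW.
  have sn0 : 0 < s + n%:R := lt_le_trans N0 sn.
  have V1 : s * (n%:R * w / ((s + 1) * X ^+ 2)) <= w / n%:R.
    have -> : s * (n%:R * w / ((s + 1) * X ^+ 2)) = (s * (n%:R * w)) / ((s + 1) * X ^+ 2) by ring.
    rewrite ler_pdivrMr; last by rewrite mulr_gt0 ?exprn_gt0 // addr_gt0.
    have -> : w / n%:R * ((s + 1) * X ^+ 2) = (s + 1) * (w * X ^+ 2 / n%:R) by ring.
    apply: ler_pM; rewrite ?mulr_ge0 ?(ltW s0) ?(ltW w0) //; first by rewrite lerDl.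
    rewrite mulrC -mulrA ler_pM2l // ler_pdivlMr //.
    by rewrite expr2; apply: ler_pM; rewrite ?(ltW N0).
  have V2 : s * (n%:R * w / (X * (s + n%:R))) ^+ 2 <= (w / n%:R) * (2 * u * w / n%:R).
    have h : n%:R * w / (X * (s + n%:R)) <= w / n%:R.
      rewrite ler_pdivrMr ?mulr_gt0 // mulrAC ler_pdivlMr //.
      have -> : n%:R * w * n%:R = w * (n%:R * n%:R) by ring.
      by rewrite ler_pM2l //; apply: ler_pM; rewrite ?(ltW N0).
    have h0 : 0 <= n%:R * w / (X * (s + n%:R)).
      by apply: divr_ge0; apply: mulr_ge0; rewrite // ltW.
    have h2 : (n%:R * w / (X * (s + n%:R))) ^+ 2 <= (w / n%:R) ^+ 2.
      by rewrite lerXn2r ?nnegrE // divr_ge0 // ltW.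
    have -> : w / n%:R * (2 * u * w / n%:R) = 2 * u * (w / n%:R) ^+ 2 by ring.
    by apply: ler_pM; rewrite ?(ltW s0) ?exprn_ge0.
  by lra.
rewrite -(big_mkord xpredT (fun r => abel_law n w s r * (1 - defect n s (n - r)))).
rewrite (@big_cat_nat _ _ _ K) //=; last exact: leqW.
rewrite [X in _ + X]big_nat_cond big_mkord.
rewrite -[X in _ <= X]addr0; apply: lerD.
  apply: ler_sum => r _.
  have rK : r%:R < n%:R - u by rewrite -KE.
  have rn : (r <= n)%N by rewrite (leq_trans _ Kn) // ltnW.
  rewrite ler_wpM2l ?abel_law_ge0 //; apply: ratio_ge => //; first exact: leq_subr.
  by rewrite natrB //; lra.
apply: sumr_le0 => r /andP[/andP[Kr rn] _].
rewrite mulr_ge0_le0 ?abel_law_ge0 // subr_le0; apply: (defect_small (u := u)) => //.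
rewrite natrB //; move: Kr; rewrite leqNgt KE -leNgt; have := u0; lra.
Qed.
End Crossing.

(** For [u < 1] both quantities differ from [1] by at most a multiple of [w/n]. For [u >= 1] compare
    through [rho], with the tangent [s] at [m = 1/n]; the factors [A] in the errors are absorbed by
    the exponential decay, since [A exp (- A/2) <= 2]. *)
Lemma crossing_estimate (R : realType) (n K : nat) (u w : R) :
  (0 < n)%N -> 0 < u -> 0 < w -> 8 * (u + w) <= n%:R ->
  (forall r : nat, (r < K)%N = (r%:R < n%:R - u)) ->
  `|crossing n K w (w + n%:R - u) - expR (- (2 * u * w / n%:R))| <=
    1600 * ((u + w) / n%:R).
Proof.
move=> n0 u0 w0 n8 KE; have N0 : 0 < n%:R :> R by rewrite ltr0n.
set B := crossing _ _ _ _; set A := 2 * u * w / n%:R; set eta := (u + w) / n%:R.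
have wN0 : 0 <= w / n%:R by rewrite divr_ge0 // ltW.
have wN : w / n%:R <= eta by rewrite ler_pM2r ?invr_gt0 // lerDr ltW.
have A0 : 0 <= A by rewrite divr_ge0 ?mulr_ge0 // ltW.
have E1 : expR (- A) <= 1 by rewrite -[X in _ <= X]expR0 ler_expR oppr_le0.
have [u1|u1] := ltP u 1.
  have /andP[] := crossing_small_u n0 u0 w0 n8 KE u1; rewrite -/B => B1 B2.
  have := expR_ge1Dx (- A).
  have : A <= 2 * (w / n%:R).
    rewrite /A -[X in _ <= X]mul1r.
    have -> : 2 * u * w / n%:R = u * (2 * (w / n%:R)) by ring.
    by rewrite ler_wpM2r ?mulr_ge0 // ltW.
  by move=> A2 EA; rewrite ler_norml; apply/andP; split; lra.
have m0 : 0 < n%:R^-1 :> R by rewrite invr_gt0.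
have um : 8 * (u * n%:R^-1) <= 1.
  by rewrite mulrA ler_pdivrMr // mul1r; lra.
have [s us tang] := exists_tangent u0 m0 um.
have /andP[us1 us2] := us.
have Ble := crossing_le n0 u0 w0 n8 KE u1 us1 tang.
have Bge := crossing_ge n0 u0 w0 n8 KE u1 us1 us2 tang.
have /andP[rho1 rho2] := rho_bounds n0 u0 w0 n8 us.
move: Ble Bge rho1 rho2; rewrite -/B -/A -/eta.
set rho := _ ^+ n => Ble Bge rho1 rho2.
have eta0 : 0 <= eta by apply: le_trans wN.
have eta8 : 8 * eta <= 1 by rewrite mulrA ler_pdivrMr // mul1r.
clearbody A eta.
have Ae0 : 0 <= A * eta by rewrite mulr_ge0.
have half : expR (- (A * (1 - 2 * eta))) <= expR (- (A / 2)).
  rewrite ler_expR lerN2; have : A * (8 * eta) <= A * 1 by rewrite ler_wpM2l.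
  by lra.
have halfA : A * expR (- (A / 2)) <= 2.
  by have := mul_expRN_le1 (A / 2); lra.
have up : rho - expR (- A) <= 4 * eta.
  have h : A * (1 - 2 * eta) <= A by lra.
  have := expR_diff_le h.
  have -> : A - A * (1 - 2 * eta) = 2 * eta * A by ring.
  have : 2 * eta * A * expR (- (A * (1 - 2 * eta))) <= 2 * eta * 2.
    rewrite -mulrA ler_wpM2l ?mulr_ge0 //.
    by apply: le_trans halfA; rewrite ler_wpM2l.
  by lra.
have lo : expR (- A) - rho <= 5 * eta.
  have h : A <= A * (1 + 5 * eta) by lra.
  have := expR_diff_le h.
  have -> : A * (1 + 5 * eta) - A = 5 * eta * A by ring.
  have : 5 * eta * A * expR (- A) <= 5 * eta * 1.
    by rewrite -mulrA ler_wpM2l ?mulr_ge0 // mul_expRN_le1.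
  by lra.
have rho_le1 : rho <= 1.
  apply: le_trans rho2 _; apply: le_trans half _.
  by rewrite -[X in _ <= X]expR0 ler_expR oppr_le0 divr_ge0.
have rhoA : rho * A <= 2.
  rewrite mulrC; apply: le_trans halfA; rewrite ler_wpM2l //.
  exact: le_trans half.
(* [rho <= 1] and [rho A <= 2] give [rho (1 + A) <= 3], and [1536 = 512 * 3]; the remaining [5 eta]
   fits into [1600 eta]. *)
have err : rho * (512 * (w / n%:R) * (1 + A)) <= 1536 * eta.
  have -> : rho * (512 * (w / n%:R) * (1 + A)) = 512 * (w / n%:R) * (rho + rho * A) by ring.
  have -> : 1536 * eta = 512 * eta * 3 by ring.
  have rho0 : 0 <= rho by apply: le_trans rho1; exact: expR_ge0.
  apply: ler_pM.
  - exact: mulr_ge0 (ler0n _ _) wN0.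
  - by rewrite addr_ge0 // mulr_ge0.
  - exact: ler_wpM2l (ler0n _ _) _ _ wN.
  - by lra.
by rewrite ler_norml; apply/andP; split; lra.
Qed.

Theorem theorem1 :
  exists C : nat, (0 < C)%N /\
  forall (R : realType) (d : measure_display) (T : measurableType d)
    (P : probability T R) (n : nat) (u v : R) (U : 'I_n -> {RV P >-> R}),
    (1 <= n)%N -> 0 < u -> 0 < v -> 0 < u + v - n%:R ->
    mutually_independent_RV P (fun i => (U i : T -> R)) ->
    (forall i, uniform01_RV P (U i)) ->
    let w := u + v - n%:R in
    let Qn := P [set x | forall t : R, 0 <= t <= 1 ->
                   empirical_df (fun i => (U i : T -> R)) x t <= (v * t + u) / n%:R] in
    (`| Qn - (1 - expR (- (2 * u * w) / n%:R))%:E | <=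
       (C%:R * (u + w) / n%:R)%:E)%E.
Proof.
exists 1600%N; split=> // R d T P n u v U n0 u0 v0 w0 indepU unifU; cbv zeta.
set w := u + v - n%:R; set Qn := P _.
have vE : v = w + n%:R - u by rewrite /w; ring.
have N0 : 0 < n%:R :> R by rewrite ltr0n.
have [K KE QE] := smirnov_formula indepU unifU n0 u0 v0 w0 vE.
rewrite -/Qn in QE.
(* One bound comes from the measure being nonnegative, the other from the terms of [crossing] being
   so. *)
have Q01 : 0 <= 1 - crossing n K w v <= 1.
  rewrite -lee_fin -QE measure_ge0 /= gerBl; apply: sumr_ge0 => r _.
  have rn : r%:R < n%:R - u by rewrite -KE.
  have r0 : 0 <= (v - w - r%:R) / v by rewrite divr_ge0 ?(ltW v0) // vE; lra.
  apply: mulr_ge0 => //; apply: mulr_ge0; last exact: exprn_ge0.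
  apply: divr_ge0; first exact: abel_ge0.
  by rewrite exprn_ge0 // ltW.
rewrite QE -EFinB abse_EFin lee_fin mulNr.
have -> : 1 - crossing n K w v - (1 - expR (- (2 * u * w / n%:R))) =
  - (crossing n K w v - expR (- (2 * u * w / n%:R))) by ring.
rewrite normrN -[X in _ <= X]mulrA.
have [n8|n8] := leP (8 * (u + w)) (n%:R).
  by have := crossing_estimate n0 u0 w0 n8 KE; rewrite -vE.
(* In the remaining case [(u + w)/n > 1/8]: the right side exceeds [200], while both compared
   quantities lie in [[0, 1]]. *)
have A0 : 0 <= 2 * u * w / n%:R by rewrite divr_ge0 ?mulr_ge0 // ltW.
have E1 : expR (- (2 * u * w / n%:R)) <= 1 by rewrite -[X in _ <= X]expR0 ler_expR oppr_le0.
have E0 := expR_ge0 (- (2 * u * w / n%:R)).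
have : 1 < 8 * ((u + w) / n%:R) by rewrite mulrA ltr_pdivlMr // mul1r.
by move=> h; rewrite ler_norml; apply/andP; split; lra.
Qed.
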